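(* Let $f\in C^1(\mathbb{R}\times\mathbb{R}_+,\mathbb{R})$ satisfy assumptions (A0)–(A7) and (H) listed in the context, and let $u\in C^1((0,\lambda_\infty),H^1(\mathbb{R}))$ be the curve such that, for each $\lambda\in(0,\lambda_\infty)$, $u(\lambda)$ is the unique positive $H^1(\mathbb{R})$-solution of $v''+f(x,v^2)v=\lambda v$ on $\mathbb{R}$. Then $$\frac{d}{d\lambda}\int_{\mathbb{R}}u(\lambda)(x)^2\,dx>0\quad\text{for all }\lambda\in(0,\lambda_\infty).$$
   Context: $\mathbb{R}_+=[0,\infty)$. All function spaces consist of real-valued functions. An $H^1(\mathbb{R})$-solution of the equation is a $v\in H^1(\mathbb{R})$ satisfying it in the sense of distributions; it is positive if $v>0$ on $\mathbb{R}$. $\partial_1,\partial_2$ denote partial derivatives with respect to the first and second arguments, and $\partial^2_{21}=\partial_2\partial_1$. Put $\widetilde f(x,s):=f(x,s^2)s$ for $x,s\in\mathbb{R}$. Assumptions on $f$ (with $C>0$ denoting constants independent of $x,s$): (A0) $f(x,0)=0$ for all $x\in\mathbb{R}$; $\lim_{s\to0}f(x,s)=0$ uniformly for $x\in\mathbb{R}$; $\lim_{|x|\to\infty}f(x,s)=0$ uniformly for $s\geq0$. (A1) $\widetilde f\in C^1(\mathbb{R}^2)$, and for all $x\in\mathbb{R}$: $\widetilde f(x,\cdot)\in C^2(\mathbb{R}\setminus\{0\})$ and $\partial_1\widetilde f(x,\cdot)\in C^1(\mathbb{R})$. (A2) There exist $b\in(0,1)$, $p\in(1,5-2b)$ and $s_0\in(0,\tfrac12]$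 such that, for $0<|s|\leq 2s_0$, both $|s\,\partial^2_{22}\widetilde f(x,s)|$ and $|x\,\partial^2_{21}\widetilde f(x,s)|$ are bounded by $C|s|^{p-1}$ for $|x|\leq1$ and by $C|x|^{-b}|s|^{p-1}$ for $|x|\geq1$. (A3) With $b,p$ from (A2) and $\theta:=(2-b)/(p-1)$, for all $x\in\mathbb{R}\setminus\{0\}$ and $s\in\mathbb{R}$: $$\lim_{k\to0^+}k^{-2}\,\partial_2\widetilde f\left(\tfrac{x}{k},k^\theta s\right)=p|x|^{-b}|s|^{p-1},\qquad \lim_{k\to0^+}k^{-(2+\theta)}\,\tfrac{x}{k}\,\partial_1\widetilde f\left(\tfrac{x}{k},k^\theta s\right)=-b|x|^{-b}|s|^{p-1}s.$$ (A4) $f(-x,s)=f(x,s)$ for all $(x,s)\in\mathbb{R}\times\mathbb{R}_+$. (A5) $\partial_1f(x,s)<0$ and $\partial_2f(x,s)>0$ for all $x,s>0$. (A6) (i) $\partial_1f(\cdot,s)\in L^\infty(\mathbb{R})$ for all $s\geq0$, and $\|\partial_1f(\cdot,s)\|_{L^\infty(\mathbb{R})}$ is uniformly bounded for $s$ in compact subsets of $\mathbb{R}_+$; (ii) $\partial_2f(\cdot,s)\in L^\infty(\mathbb{R})$ for all $s\geq0$, and the family $\{\partial_2f(x,\cdot)\}_{x\in\mathbb{R}}$ is equicontinuous. (A7) There exists $f_\infty\in C(\mathbb{R})\cap L^\infty(\mathbb{R})$ such that $\lim_{s\to\infty}f(x,s)=f_\infty(x)$ uniformly for $x\in\mathbb{R}$,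 and $f_\infty(0)>\lim_{|x|\to\infty}f_\infty(x)$. (H) The function $$h(x,s):=\frac{2f(x,s)+x\,\partial_1f(x,s)}{\partial_2f(x,s)\,s}-1,\qquad x>0,\ s>0,$$ is positive and is non-increasing as $x$ increases and $s$ decreases, i.e. $h(x_2,s_2)\leq h(x_1,s_1)$ whenever $0<x_1\leq x_2$ and $s_1\geq s_2>0$. The number $\lambda_\infty$ is defined by $$-\lambda_\infty:=\inf_{v\in H^1(\mathbb{R})\setminus\{0\}}\frac{\int_{\mathbb{R}}\big((v')^2-f_\infty(x)v^2\big)\,dx}{\int_{\mathbb{R}}v^2\,dx}.$$ Under (A0)–(A7), $\lambda_\infty\in(0,\infty)$ and the curve $u$ exists; moreover each $u(\lambda)$ is even, of class $C^3$, strictly decreasing on $(0,\infty)$ and exponentially decaying, and $\|u(\lambda)\|_{L^2(\mathbb{R})}$, $\|u(\lambda)'\|_{L^2(\mathbb{R})}$, $\|u(\lambda)\|_{L^\infty(\mathbb{R})}\to0$ as $\lambda\to0$. *)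

(* Defs.v *)
From HB Require Import structures.
From mathcomp Require Import all_boot all_order all_algebra.
From mathcomp Require Import all_classical all_reals all_analysis.
Set Implicit Arguments.
Unset Strict Implicit.
Unset Printing Implicit Defensive.
Import Order.TTheory GRing.Theory Num.Theory.
Import numFieldNormedType.Exports.
Local Open Scope classical_set_scope.
Local Open Scope ring_scope.

Section Derivatives.
Context {R : realType}.

Definition pd1 (g : R -> R -> R) (x s : R) : R := derive1 (g^~ s) x.

Definition pd2 (g : R -> R -> R) (x s : R) : R := derive1 (g x) s.

(* Partial derivative in s relative to the half-plane s >= 0: the usual one for
   s > 0 and the right derivative for s = 0. *)
Definition dquot_plus (f : R -> R -> R) (x s : R) : set_system R :=
  (fun h => h^-1 * (f x (s + h) - f x s)) @ within [set h | 0 <= s + h] 0^'.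

Definition pd2_plus (f : R -> R -> R) (x s : R) : R := lim (dquot_plus f x s).

Definition C1_plane (g : R -> R -> R) : Prop :=
  [/\ forall x s : R, derivable (g^~ s) x 1,
      forall x s : R, derivable (g x) s 1,
      continuous (fun z : R * R => pd1 g z.1 z.2) &
      continuous (fun z : R * R => pd2 g z.1 z.2)].

(* f in C^1(R x R_+); the values f x s with s < 0 are never used. *)
Definition C1_half_plane (f : R -> R -> R) : Prop :=
  let D := [set z : R * R | 0 <= z.2] in
  [/\ forall x s : R, 0 <= s -> derivable (f^~ s) x 1,
      forall x s : R, 0 <= s -> cvg (dquot_plus f x s),
      {within D, continuous (fun z : R * R => pd1 f z.1 z.2)} &
      {within D, continuous (fun z : R * R => pd2_plus f z.1 z.2)}].

(* C^n on an open subset A of the line *)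
Definition Cn_on (A : set R) (n : nat) (g : R -> R) : Prop :=
  (forall i, (i < n)%N -> forall x : R, A x -> derivable (derive1n i g) x 1) /\
  (forall x : R, A x -> {for x, continuous (derive1n n g)}).

End Derivatives.

Section Sobolev.
Context {R : realType}.
Let mu := @lebesgue_measure R.

Definition test_function (phi : R -> R) : Prop :=
  (forall n, Cn_on setT n phi) /\ compact (closure [set x | phi x != 0]).

Definition is_weak_derivative (v w : R -> R) : Prop :=
  forall phi : R -> R, test_function phi ->
    (\int[mu]_x (v x * derive1 phi x) = - \int[mu]_x (w x * phi x))%R.

(* By the Sobolev embedding every class in H^1(R) has exactly one continuous
   representative; an element of H^1(R) is encoded by that representative, so
   that equality of functions is equality in H^1(R) and pointwise positivity
   makes sense. *)
Definition H1 (v : R -> R) : Prop :=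
  [/\ continuous v, v \in Lfun mu 2%:E &
      exists2 w : R -> R, w \in Lfun mu 2%:E & is_weak_derivative v w].

(* A weak derivative in L^2, unique up to null sets (junk value 0 off H^1(R)) *)
Definition weak_derivative (v : R -> R) : R -> R :=
  xget (cst 0) [set w | w \in Lfun mu 2%:E /\ is_weak_derivative v w].

Definition H1norm (v : R -> R) : R :=
  Num.sqrt (\int[mu]_x (v x ^+ 2) + \int[mu]_x (weak_derivative v x ^+ 2))%R.

(* u in C^1(]a, b[, H^1(R)), with derivative du with respect to the H^1-norm *)
Definition C1_curve_H1 (a b : R) (u : R -> R -> R) : Prop :=
  exists du : R -> R -> R,
    forall l : R, a < l < b ->
      [/\ H1 (u l), H1 (du l),
          H1norm (h^-1 *: (u (l + h) - u l) - du l) @[h --> 0^'] --> 0 &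
          H1norm (du m - du l) @[m --> l] --> 0].

End Sobolev.

Section Assumptions.
Context {R : realType}.
Let mu := @lebesgue_measure R.
Implicit Types (f : R -> R -> R) (b p : R) (finf : R -> R).

Definition ftilde f (x s : R) : R := f x (s ^+ 2) * s.

Definition A0 f : Prop :=
  [/\ forall x : R, f x 0 = 0,
      forall e : R, 0 < e -> \forall s \near 0^'+, forall x : R, `|f x s| < e &
      forall e : R, 0 < e -> exists M : R, forall x s : R, M <= `|x| -> 0 <= s ->
        `|f x s| < e].

Definition A1 f : Prop :=
  [/\ C1_plane (ftilde f),
      forall x : R, Cn_on [set s | s != 0] 2 (ftilde f x) &
      forall x : R, Cn_on setT 1 (pd1 (ftilde f) x)].

Definition A2 f b p : Prop :=
  [/\ 0 < b < 1, 1 < p < 5 - 2 * b &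
    exists s0 C : R, [/\ 0 < s0 <= 2^-1, 0 < C &
      forall x s : R, 0 < `|s| <= 2 * s0 ->
        (`|x| <= 1 ->
           `|s * pd2 (pd2 (ftilde f)) x s| <= C * `|s| `^ (p - 1) /\
           `|x * pd2 (pd1 (ftilde f)) x s| <= C * `|s| `^ (p - 1)) /\
        (1 <= `|x| ->
           `|s * pd2 (pd2 (ftilde f)) x s|
             <= C * `|x| `^ (- b) * `|s| `^ (p - 1) /\
           `|x * pd2 (pd1 (ftilde f)) x s|
             <= C * `|x| `^ (- b) * `|s| `^ (p - 1))]].

Definition A3 f b p : Prop :=
  let theta := (2 - b) / (p - 1) in
  forall x s : R, x != 0 ->
    k ^- 2 * pd2 (ftilde f) (x / k) (k `^ theta * s) @[k --> 0^'+]
      --> p * `|x| `^ (- b) * `|s| `^ (p - 1) /\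
    k `^ (- (2 + theta)) * (x / k) * pd1 (ftilde f) (x / k) (k `^ theta * s)
      @[k --> 0^'+] --> - b * `|x| `^ (- b) * `|s| `^ (p - 1) * s.

Definition A4 f : Prop := forall x s : R, 0 <= s -> f (- x) s = f x s.

Definition A5 f : Prop :=
  forall x s : R, 0 < x -> 0 < s -> pd1 f x s < 0 /\ 0 < pd2_plus f x s.

Definition A6 f : Prop :=
  [/\ forall s : R, 0 <= s -> (pd1 f)^~ s \in Lfun mu +oo%E,
      forall K : set R, compact K -> K `<=` [set s | 0 <= s] ->
        exists M : R, forall s : R, K s ->
          (Lnorm mu +oo (fun x => (pd1 f x s)%:E) <= M%:E)%E,
      forall s : R, 0 <= s -> (pd2_plus f)^~ s \in Lfun mu +oo%E &
      equicontinuous [set: R]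
        (fun x => pd2_plus f x : subspace [set s : R | 0 <= s] -> R)].

Definition A7 f finf : Prop :=
  [/\ continuous finf, finf \in Lfun mu +oo%E,
      forall e : R, 0 < e -> \forall s \near +oo, forall x : R, `|f x s - finf x| < e &
      exists l : R, [/\ finf x @[x --> +oo] --> l, finf x @[x --> -oo] --> l &
        l < finf 0]].

Definition hfun f (x s : R) : R :=
  (2 * f x s + x * pd1 f x s) / (pd2_plus f x s * s) - 1.

Definition AH f : Prop :=
  (forall x s : R, 0 < x -> 0 < s -> 0 < hfun f x s) /\
  (forall x1 x2 s1 s2 : R, 0 < x1 <= x2 -> 0 < s2 <= s1 ->
     hfun f x2 s2 <= hfun f x1 s1).

Definition rayleigh finf (v : R -> R) : R :=
  ((\int[mu]_x (weak_derivative v x ^+ 2 - finf x * v x ^+ 2))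
    / (\int[mu]_x (v x ^+ 2)))%R.

Definition lambda_inf finf : R :=
  - inf [set rayleigh finf v | v in [set v | H1 v /\ v <> cst 0]].

(* v'' + f(x, v^2) v = l v in the sense of distributions *)
Definition weak_solution f (l : R) (v : R -> R) : Prop :=
  forall phi : R -> R, test_function phi ->
    (\int[mu]_x (v x * derive1n 2 phi x)
     + \int[mu]_x (f x (v x ^+ 2) * v x * phi x)
     = l * \int[mu]_x (v x * phi x))%R.

Definition positive_H1_solution f (l : R) (v : R -> R) : Prop :=
  [/\ H1 v, weak_solution f l v & forall x : R, 0 < v x].

End Assumptions.

(* Main.v *)
(* Write g(x,s) = f(x,s^2) s, let u = u(l) and v = du/dl, and let w = u (g_s(x,u) - f(x,u^2)) / 2,
   which is positive for x > 0. Differentiating the equation in l gives L v = u with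
   L = d^2/dx^2 + g_s(x,u) - l; moreover L u = 2 w and, by the definition of h,
   L(x u') = 2 l u - (h(x,u^2) + 1) w. Green's formula on (0,oo), where u and v are even,
   turns these into  2 l int u v = int h w v  and  int w v = (1/2) int u^2 > 0.
   Since L(-u') < 0 < -u' on (0,oo), the maximum principle shows that {v > 0} is an interval
   [0,c). As h(x,u(x)^2) is nonincreasing, (h - h(c)) w v >= 0, whence
   2 l int u v >= (h(c)/2) int u^2 > 0 when c is finite, while int u v > 0 is clear otherwise.
   Finally d/dl int u^2 = 2 int u v.

   Smoothness of u and v comes from du Bois-Reymond arguments, evenness from uniqueness, and
   u' < 0 from an energy with frozen coefficient; boundary terms need only vanish along a
   sequence, so no decay of v' is required. *)
Require Import Defs.
From HB Require Import structures.
From mathcomp Require Import all_boot all_order all_algebra.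
From mathcomp Require Import ring lra.
From mathcomp Require Import all_classical all_reals all_analysis measurable_realfun.
Import Order.TTheory GRing.Theory Num.Theory.
Import numFieldNormedType.Exports.
Local Open Scope classical_set_scope.
Local Open Scope ring_scope.
Set Implicit Arguments.
Unset Strict Implicit.
Unset Printing Implicit Defensive.

(** * Calculus on the line *)

Section Calculus.
Context {R : realType}.
Implicit Types (f g F G u v : R -> R) (a b c d e x y : R).

(** Each boundary expression is an explicit function ([Wr], [Z], [B]) whose derivative is the
    integrand; only its values at particular points and its smallness at points tending to infinity
    enter. Such points come from the mean value theorem: v tends to 0, so every unit interval far
    out contains a point where v' is small too. The factor x brought in by x u' is paid for by
    bounds on x^2 u, x^2 u' and x^2 u''. What is bounded below is the primitive of u v vanishing at
    0. It is odd, and the integral over the line is the limit of twice its values, so a bound along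
    a sequence suffices. Freezing the coefficient in the energy keeps the primitive of g in one
    variable only, so no primitive has to be differentiated in x. Elements of H^1 are known only
    through tests against smooth functions of compact support; their values are recovered by testing
    with smooth plateaus, all built from exp(-1/x). *)

Lemma is_deriveD1 f g x a b : is_derive x 1 f a -> is_derive x 1 g b ->
  is_derive x 1 (fun y => f y + g y) (a + b).
Proof. by move=> hf hg; exact: is_deriveD. Qed.

Lemma is_deriveB1 f g x a b : is_derive x 1 f a -> is_derive x 1 g b ->
  is_derive x 1 (fun y => f y - g y) (a - b).
Proof. by move=> hf hg; exact: is_deriveB. Qed.

Lemma is_deriveN1 f x a : is_derive x 1 f a ->
  is_derive x 1 (fun y => - f y) (- a).
Proof. by move=> hf; exact: is_deriveN. Qed.

Lemma is_deriveM1 f g x a b : is_derive x 1 f a -> is_derive x 1 g b ->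
  is_derive x 1 (fun y => f y * g y) (a * g x + f x * b).
Proof.
move=> hf hg; apply: (is_derive_eq (is_deriveM hf hg)).
by rewrite /GRing.scale/= addrC (mulrC (g x)).
Qed.

Lemma is_deriveX1 f n x a : is_derive x 1 f a ->
  is_derive x 1 (fun y => f y ^+ n.+1) (n.+1%:R * f x ^+ n * a).
Proof.
move=> hf; have -> : (fun y => f y ^+ n.+1) = f ^+ n.+1.
  by apply/funext => y; rewrite exprfctE.
apply: (is_derive_eq (is_deriveX n.+1 hf)).
by rewrite /GRing.scale/= mulr_natl.
Qed.

Lemma is_derive1_cst (k : R) x : is_derive x 1 (fun=> k) 0.
Proof. exact: is_derive_cst. Qed.

Lemma is_derive1_id x : is_derive x 1 (fun y => y) 1.
Proof. exact: is_derive_id. Qed.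

Lemma is_derive_comp1 f g x a b : is_derive (g x) 1 f a -> is_derive x 1 g b ->
  is_derive x 1 (fun y => f (g y)) (a * b).
Proof. by move=> hf hg; exact: is_derive1_comp. Qed.

Lemma is_derive_affine f x a b c : is_derive (c * x + b) 1 f a ->
  is_derive x 1 (fun y => f (c * y + b)) (a * c).
Proof.
move=> hf; apply: is_derive_comp1 => //.
apply: (is_derive_eq (is_deriveD1 (is_deriveM1 (is_derive1_cst c x) (is_derive1_id x))
  (is_derive1_cst b x))).
by rewrite mul0r add0r mulr1 addr0.
Qed.

Lemma is_derive_continuous f x a : is_derive x 1 f a -> {for x, continuous f}.
Proof. by move=> [h _]; apply: differentiable_continuous; exact/derivable1_diffP. Qed.

Lemma is_derive1P f x a : is_derive x 1 f a <-> derivable f x 1 /\ derive1 f x = a.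
Proof. by rewrite derive1E; split=> [[]|[]]. Qed.

Lemma derivable_is_derive f x : derivable f x 1 -> is_derive x 1 f (derive1 f x).
Proof. by move=> h; apply/is_derive1P. Qed.

Lemma derivable_eq_continuous f (df : R -> R) :
  (forall x, is_derive x 1 f (df x)) -> continuous f.
Proof. by move=> hf x; exact: is_derive_continuous (hf x). Qed.

Lemma is_derive_within f (df : R -> R) a b :
  (forall x, a <= x <= b -> is_derive x 1 f (df x)) ->
  {within `[a, b], continuous f}.
Proof.
move=> hf; apply: derivable_within_continuous => x; rewrite in_itv/= => xab.
by have [] := hf x xab.
Qed.

Lemma mean_value f (df : R -> R) a b : a < b ->
  (forall x, a <= x <= b -> is_derive x 1 f (df x)) ->
  exists2 c, a < c < b & f b - f a = df c * (b - a).
Proof.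
move=> ab hf; have [x|c|c cab ->] := MVT (f := f) (df := df) ab.
- by rewrite in_itv/= => /andP[ax xb]; apply: hf; rewrite !ltW.
- exact: is_derive_within hf c.
- by exists c => //; rewrite in_itv/= in cab.
Qed.

Lemma derive_ge0_le f (df : R -> R) a b : a <= b ->
  (forall x, a <= x <= b -> is_derive x 1 f (df x)) ->
  (forall x, a < x < b -> 0 <= df x) -> f a <= f b.
Proof.
rewrite le_eqVlt => /predU1P[-> //|ab] hf h0.
have [c /h0 dc e] := mean_value ab hf.
by rewrite -subr_ge0 e mulr_ge0// subr_ge0 ltW.
Qed.

Lemma derive_le0_le f (df : R -> R) a b : a <= b ->
  (forall x, a <= x <= b -> is_derive x 1 f (df x)) ->
  (forall x, a < x < b -> df x <= 0) -> f b <= f a.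
Proof.
rewrite le_eqVlt => /predU1P[-> //|ab] hf h0.
have [c /h0 dc e] := mean_value ab hf.
by rewrite -subr_le0 e mulr_le0_ge0// subr_ge0 ltW.
Qed.

Lemma derive_gt0_lt f (df : R -> R) a b : a < b ->
  (forall x, a <= x <= b -> is_derive x 1 f (df x)) ->
  (forall x, a < x < b -> 0 < df x) -> f a < f b.
Proof.
move=> ab hf h0; have [c /h0 dc e] := mean_value ab hf.
by rewrite -subr_gt0 e mulr_gt0// subr_gt0.
Qed.

Lemma derive_lt0_lt f (df : R -> R) a b : a < b ->
  (forall x, a <= x <= b -> is_derive x 1 f (df x)) ->
  (forall x, a < x < b -> df x < 0) -> f b < f a.
Proof.
move=> ab hf h0; have [c /h0 dc e] := mean_value ab hf.
by rewrite -subr_lt0 e nmulr_rlt0// subr_gt0.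
Qed.

Lemma derive_eq0_cst f : (forall x, is_derive x 1 f 0) -> forall x y, f x = f y.
Proof. by move=> h x y; exact: is_derive_0_is_cst. Qed.

Lemma nbhs_dist (P : set R) x :
  nbhs x P <-> exists2 d, 0 < d & forall y, `|y - x| < d -> P y.
Proof.
split=> [/nbhs_ballP[d /= d0 h]|[d d0 h]].
  by exists d => // y yx; apply: h; rewrite /ball/= distrC.
by apply/nbhs_ballP; exists d => //= y; rewrite /ball/= distrC => /h.
Qed.

Lemma continuousP_dist f x : {for x, continuous f} <->
  forall e, 0 < e -> exists2 d, 0 < d & forall y, `|y - x| < d -> `|f y - f x| < e.
Proof.
split=> [/cvgrPdist_lt h e /h /nbhs_dist[d d0 hd]|h].
  by exists d => // y /hd; rewrite distrC.
apply/cvgrPdist_lt => e /h[d d0 hd]; apply/nbhs_dist; exists d => // y /hd.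
by rewrite distrC.
Qed.

(** Caratheodory's slope function is continuous and negative at [x], hence negative nearby. This
    serves to fix the direction in which a function crosses a zero. *)
Lemma is_derive_sign f x a : is_derive x 1 f a -> a < 0 ->
  exists2 d, 0 < d & forall y, `|y - x| < d ->
    (x < y -> f y < f x) /\ (y < x -> f x < f y).
Proof.
move=> /is_derive1_caratheodory[g [fE cg gx]] a0.
have /continuousP_dist/(_ (- a)) := cg; rewrite oppr_gt0 => /(_ a0)[d d0 hd].
exists d => // y /hd; rewrite gx ltr_norml => /andP[_ h].
have gy : g y < 0 by lra.
have e := fE y.
split=> xy; rewrite -subr_lt0.
  by rewrite e nmulr_rlt0// subr_gt0.
by rewrite -opprB e oppr_lt0 nmulr_rgt0// subr_lt0.
Qed.

(** The integral from - N has the right derivative only beyond - N, so the lower limit must move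
    with x. Subtracting the value at 0 makes the result independent of N ([IE]), and near x the
    limit - (|x| + 2) serves all points at once. *)
Lemma continuous_primitive f : continuous f ->
  exists2 F : R -> R, (forall x, is_derive x 1 F (f x)) & F 0 = 0.
Proof.
move=> cf; pose mu := @lebesgue_measure R.
have fi a b : mu.-integrable `[a, b] (EFin \o f).
  apply: continuous_compact_integrable; first exact: segment_compact.
  exact: continuous_subspaceT.
pose I (N x : R) := \int[mu]_(t in `[- N, x]) f t - \int[mu]_(t in `[- N, 0]) f t.
have IE N M x : - N < x -> 0 < N -> N <= M -> I N x = I M x.
  move=> Nx N0 NM.
  have key y : - N <= y -> \int[mu]_(t in `[- M, y]) f t =
      \int[mu]_(t in `[- M, - N]) f t + \int[mu]_(t in `[- N, y]) f t.
    move=> Ny; apply/eqP; rewrite addrC -subr_eq; apply/eqP.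
    rewrite Rintegral_itvB//.
    - rewrite Rintegral_itv_obnd_cbnd//; apply: integrableS (fi (-N) y) => //.
      by apply: subset_itvr; rewrite bnd_simp.
    - by rewrite bnd_simp lerN2.
  by rewrite /I (key x) ?(key 0) ?oppr_le0 ?ltW//; ring.
exists (fun x => I (`|x| + 1) x) => [x|]; last by rewrite /I subrr.
have x1 : 0 < `|x| + 2 by rewrite ltr_pwDr.
have xx : - (`|x| + 2) < x.
  by rewrite ltrNl (@le_lt_trans _ _ `|x|) ?ltrDl// -normrN ler_norm.
apply: (@near_eq_is_derive _ _ _ (I (`|x| + 2))).
  near=> y; apply/esym/IE.
  - by rewrite ltrNl (@le_lt_trans _ _ `|y|) ?ltrDl// -normrN ler_norm.
  - by rewrite ltr_pwDr.
  - have : `|y - x| < 1.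
      near: y; apply/nbhs_dist; exists 1 => //.
    have : `|y| <= `|y - x| + `|x| by rewrite -{1}(subrK x y) ler_normD.
    lra.
have xS : x < x + 1 by rewrite ltrDl.
have [h1 h2] := continuous_FTC1_closed xS (fi _ _) xx (cf x).
have h : is_derive x 1 (fun y => \int[mu]_(t in `[- (`|x| + 2), y]) f t) (f x).
  by apply/is_derive1P.
apply: is_derive_eq (is_deriveB1 h (is_derive1_cst _ x)) _.
by rewrite subr0.
Unshelve. all: by end_near. Qed.

End Calculus.

(** * Smooth functions and test functions *)

Section Smooth.
Context {R : realType}.
Implicit Types (f g F G phi : R -> R) (a b c d e x y M : R).

Lemma is_deriveV1 f x a : f x != 0 -> is_derive x 1 f a ->
  is_derive x 1 (fun y => (f y)^-1) (- (f x) ^- 2 * a).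
Proof. by move=> f0 hf; exact: is_deriveV. Qed.

Lemma is_derive_quadratic f x c : (forall z, `|f z - f x| <= c * (z - x) ^+ 2) ->
  is_derive x 1 f 0.
Proof.
move=> h; apply/is_derive1_caratheodory.
exists (fun z => if z == x then 0 else (f z - f x) / (z - x)); split.
- move=> z; case: eqVneq => [->|zx]; first by rewrite !subrr mul0r.
  by rewrite divfK// subr_eq0.
- apply/continuousP_dist => e e0; rewrite eqxx.
  (* The bound at distance 1 from x forces the constant to be nonnegative. *)
  have c0 : 0 <= c by have := h (x + 1); rewrite addrAC subrr add0r expr1n mulr1; apply: le_trans.
  exists (e / (c + 1)); first by rewrite divr_gt0// ltr_pwDr.
  move=> y; case: eqVneq => [_|yx]; first by rewrite subrr normr0.
  have yx0 : 0 < `|y - x| by rewrite normr_gt0 subr_eq0.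
  rewrite ltr_pdivlMr ?ltr_pwDr// subr0 normrM normfV => yxe.
  rewrite ltr_pdivrMr//; apply: le_lt_trans (h y) _.
  rewrite -real_normK ?num_real// expr2 mulrA ltr_pM2r//.
  by apply: le_lt_trans yxe; rewrite mulrC ler_wpM2l// lerDl.
- by rewrite eqxx.
Qed.

(** The derivative is carried as a witness, so that closure under sums, products and affine
    substitutions is a plain induction; [Cn_onP] identifies this notion with [Cn_on] on the whole
    line. *)
Fixpoint Ck n f : Prop := if n is m.+1
  then exists2 f', (forall x, is_derive x 1 f (f' x)) & Ck m f' else continuous f.

Lemma Ck_continuous n f : Ck n f -> continuous f.
Proof. by case: n => [//|n [f' df _]]; exact: derivable_eq_continuous df. Qed.

Lemma Ck_pred n f : Ck n.+1 f -> Ck n f.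
Proof.
elim: n f => [f /Ck_continuous//|n IH f [f' df /IH cf']].
by exists f'.
Qed.

Lemma Ck_cst n c : Ck n (fun=> c).
Proof.
elim: n c => [c|n IH c]; first exact: cst_continuous.
by exists (fun=> 0) => // x; exact: is_derive1_cst.
Qed.

Lemma CkD n f g : Ck n f -> Ck n g -> Ck n (fun x => f x + g x).
Proof.
elim: n f g => [f g cf cg x|n IH f g [f' df cf'] [g' dg cg']].
  by apply: cvgD; [exact: cf|exact: cg].
by exists (fun x => f' x + g' x); [move=> x; exact: is_deriveD1|exact: IH].
Qed.

Lemma CkM n f g : Ck n f -> Ck n g -> Ck n (fun x => f x * g x).
Proof.
elim: n f g => [f g cf cg x|n IH f g Cf Cg].
  by apply: cvgM; [exact: cf|exact: cg].
have [f' df cf'] := Cf; have [g' dg cg'] := Cg.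
exists (fun x => f' x * g x + f x * g' x); first by move=> x; exact: is_deriveM1.
by apply: CkD; apply: IH => //; exact: Ck_pred.
Qed.

Lemma Ck_affine n f c b : Ck n f -> Ck n (fun x => f (c * x + b)).
Proof.
elim: n f => [f cf|n IH f [f' df cf']].
  move=> x; apply: continuous_comp; last exact: cf.
  apply: cvgD; last exact: cvg_cst.
  by apply: cvgM; [exact: cvg_cst|exact: cvg_id].
exists (fun x => f' (c * x + b) * c); first by move=> x; exact: is_derive_affine.
by apply: CkM; [exact: IH|exact: Ck_cst].
Qed.

Lemma derive1nE f f' n : (forall x, is_derive x 1 f (f' x)) ->
  derive1n n.+1 f = derive1n n f'.
Proof.
move=> df; rewrite derive1Sn; congr (derive1n n _).
by apply/funext => x; have /is_derive1P[] := df x.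
Qed.

Lemma Cn_onP n f : Cn_on setT n f <-> Ck n f.
Proof.
elim: n f => [f|n IH f]; split.
- by move=> [_ h] x; exact: h.
- by move=> cf; split=> // x _; exact: cf.
- move=> [h1 h2]; have df x : is_derive x 1 f (derive1 f x).
    by apply: derivable_is_derive; exact: (h1 0%N).
  exists (derive1 f) => //; apply/IH; split.
    by move=> i ni x _; rewrite -derive1Sn; exact: h1.
  by move=> x _; rewrite -derive1Sn; exact: h2.
- move=> [f' df /IH[h1 h2]]; split; last by rewrite (derive1nE _ df).
  case=> [_ x _|i ni x _]; first by case: (df x).
  by rewrite (derive1nE _ df); exact: h1.
Qed.

Definition supported phi M : Prop := forall x, M < `|x| -> phi x = 0.

Lemma test_functionP phi : test_function phi <->
  (forall n, Ck n phi) /\ exists M, supported phi M.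
Proof.
split=> [[Cphi cphi]|[Cphi [M sphi]]].
  split=> [n|]; first exact/Cn_onP.
  have [N [_ h]] := compact_bounded cphi.
  exists (N + 1) => x Nx; apply/eqP; apply: contraLR (Nx) => phix.
  by rewrite -leNgt; apply: (h (N + 1)); rewrite ?ltrDl//; exact: subset_closure.
split=> [n|]; first exact/Cn_onP.
have cl : closed `[- M, M]%classic by exact: interval_closed.
apply: (subclosed_compact _ (@segment_compact _ (- M) M)).
  exact: closed_closure.
rewrite [X in _ `<=` X](closure_id _).1//; apply: closure_subset => x /= phix.
rewrite in_itv/= -ler_norml leNgt; apply: contra phix => /sphi ->; exact/eqP.
Qed.

Lemma test_function_continuous phi : test_function phi -> continuous phi.
Proof. by move=> /test_functionP[/(_ 0%N)]. Qed.

Lemma is_derive_supported phi phi' M : (forall x, is_derive x 1 phi (phi' x)) ->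
  supported phi M -> supported phi' M.
Proof.
move=> dphi sphi x Mx.
have h : is_derive x 1 phi 0.
  apply: (near_eq_is_derive _ (is_derive1_cst 0 x)).
  have : {for x, continuous (fun y : R => `|y|)} by exact: norm_continuous.
  move/continuousP_dist/(_ (`|x| - M)); rewrite subr_gt0 => /(_ Mx)[d d0 hd].
  apply/nbhs_dist; exists d => // y /hd; rewrite ltr_norml => /andP[h _].
  by rewrite sphi//; move: h; lra.
by have /is_derive1P[_ <-] := dphi x; have /is_derive1P[_ <-] := h.
Qed.

Lemma test_function_derive phi phi' : (forall x, is_derive x 1 phi (phi' x)) ->
  test_function phi -> test_function phi'.
Proof.
move=> dphi /test_functionP[Cphi [M sphi]]; apply/test_functionP; split.
  move=> n; have [f' df' Cf'] := Cphi n.+1.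
  suff -> : phi' = f' by [].
  by apply/funext => x; have /is_derive1P[_ <-] := dphi x; have /is_derive1P[_ <-] := df' x.
by exists M; exact: is_derive_supported sphi.
Qed.

Lemma test_function_is_derive phi : test_function phi ->
  forall x, is_derive x 1 phi (derive1 phi x).
Proof.
move=> /test_functionP[/(_ 1%N)[phi' d _] _] x; apply: derivable_is_derive.
by case: (d x).
Qed.

(* x^-k exp(-1/x), extended by 0; the derivative is again of this form. *)
Definition flat (k : nat) x : R := if 0 < x then x ^- k * expR (- x^-1) else 0.

(** With n = k + 2, exp(1/x) is the n-th power of exp(1/(n x)), which exceeds 1/(n x). The two spare
    powers of x are what [is_derive_quadratic] asks for at 0. *)
Lemma flat_le k x : 0 <= flat k x <= (k.+2)%:R ^+ k.+2 * x ^+ 2.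
Proof.
rewrite /flat; case: ifPn => [x0|_]; last first.
  by rewrite lexx mulr_ge0 ?sqr_ge0 ?exprn_ge0.
rewrite mulr_ge0 ?expR_ge0 ?invr_ge0 ?exprn_ge0 ?(ltW x0)//=.
have kx : 0 < k.+2%:R * x by rewrite mulr_gt0.
have h : (k.+2%:R * x) ^- k.+2 <= expR x^-1.
  have -> : x^-1 = (k.+2%:R * x)^-1 * k.+2%:R by rewrite invfM mulrAC mulVf// mul1r.
  rewrite expRM_natr -exprVn; apply: lerXn2r; rewrite ?nnegrE ?expR_ge0 ?invr_ge0 ?ltW//.
  by apply: lt_le_trans (expR_ge1Dx _); rewrite ltrDr.
rewrite expRN ler_pdivrMr ?expR_gt0//; apply: le_trans (ler_wpM2l _ h).
  have Kn0 : k.+2%:R ^+ k.+2 != 0 :> R by rewrite expf_neq0.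
  have xk0 : x ^+ k != 0 by rewrite expf_neq0// gt_eqF.
  have xn0 : x != 0 by rewrite gt_eqF.
  have e : x ^+ k.+2 = x ^+ 2 * x ^+ k by rewrite -exprD.
  rewrite exprMn e; move: (k.+2%:R ^+ k.+2) Kn0 (x ^+ k) xk0 => K K0 X X0.
  rewrite le_eqVlt; apply/orP; left; apply/eqP; field.
  by rewrite X0 xn0 K0.
by rewrite mulr_ge0 ?sqr_ge0 ?exprn_ge0.
Qed.

Lemma is_derive_flat k x : is_derive x 1 (flat k) (- k%:R * flat k.+1 x + flat k.+2 x).
Proof.
case: (ltgtP x 0) => [x0|x0|->].
- rewrite /flat ltNge (ltW x0) /= mulr0 addr0.
  apply: (near_eq_is_derive _ (is_derive1_cst 0 x)).
  apply/nbhs_dist; exists (- x); first by rewrite oppr_gt0.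
  move=> y; rewrite ltr_norml => /andP[_ h].
  by rewrite ifF//; apply/negbTE; rewrite -leNgt; move: h; lra.
- rewrite /flat x0; have xn0 : x != 0 by rewrite gt_eqF.
  apply: (@near_eq_is_derive _ _ _ (fun y => (y ^+ k)^-1 * expR (- y^-1))).
    apply/nbhs_dist; exists x => // y.
    by rewrite ltr_norml => /andP[h _]; rewrite ifT//; move: h; lra.
  have d1 : is_derive x 1 (fun y => y ^+ k) (k%:R * x ^+ k / x).
    case: k => [|k]; first by rewrite !mul0r; exact: is_derive1_cst.
    apply: is_derive_eq (is_deriveX1 k (is_derive1_id x)) _.
    by rewrite exprSr mulr1 -!mulrA divff// mulr1.
  have d2 : is_derive x 1 (fun y => expR (- y^-1)) (expR (- x^-1) * (x ^- 2)).
    apply: is_derive_comp1.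
    apply: is_derive_eq (is_deriveN1 (is_deriveV1 xn0 (is_derive1_id x))) _.
    by rewrite mulr1 opprK.
  apply: is_derive_eq (is_deriveM1 (@is_deriveV1 (fun y => y ^+ k) _ _ (expf_neq0 k xn0) d1) d2) _.
  have := expf_neq0 k xn0; rewrite !exprS; move: (x ^+ k) => X X0.
  by field; rewrite X0 xn0.
- rewrite /flat ltxx mulr0 addr0.
  apply: (@is_derive_quadratic _ _ ((k.+2)%:R ^+ k.+2)) => z.
  have /andP[h1 h2] := flat_le k z.
  by rewrite -!/(flat _ _) {2}/flat ltxx !subr0 ger0_norm.
Qed.

Lemma Ck_flat n k : Ck n (flat k).
Proof.
elim: n k => [k|n IH k]; first exact: derivable_eq_continuous (is_derive_flat k).
exists (fun x => - k%:R * flat k.+1 x + flat k.+2 x); first exact: is_derive_flat.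
by apply: CkD => //; apply: CkM => //; exact: Ck_cst.
Qed.

(* S is the normalised primitive of the bump exp(-1/x) exp(-1/(1-x)). *)
Lemma smooth_step : exists S s : R -> R,
  [/\ forall x, is_derive x 1 S (s x), forall n, Ck n s,
      forall x, x <= 0 -> S x = 0, forall x, 1 <= x -> S x = 1 &
      forall x, 0 <= s x].
Proof.
pose s0 x := flat 0 x * flat 0 ((-1) * x + 1).
have Cs0 n : Ck n s0 by apply: CkM; [|apply: (@Ck_affine _ (flat 0))]; exact: Ck_flat.
have s0_ge0 x : 0 <= s0 x.
  by rewrite mulr_ge0//; [have /andP[] := flat_le 0 x|have /andP[] := flat_le 0 ((-1) * x + 1)].
have [F dF F0] := continuous_primitive (Cs0 0%N).
have F1 : 0 < F 1.
  rewrite -F0; apply: (derive_gt0_lt (df := s0)) => // x /andP[x0 x1].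
  rewrite /s0 /flat x0 ifT; last by lra.
  by rewrite !expr0 !invr1 !mul1r mulr_gt0 ?expR_gt0.
exists (fun x => F x * (F 1)^-1), (fun x => s0 x * (F 1)^-1); split.
- move=> x; apply: is_derive_eq (is_deriveM1 (dF x) (is_derive1_cst _ _)) _.
  by rewrite mulr0 addr0.
- by move=> n; apply: CkM => //; exact: Ck_cst.
- move=> x x0; suff -> : F x = 0 by rewrite mul0r.
  apply/eqP; rewrite eq_le -F0; apply/andP; split.
    by apply: (derive_ge0_le (df := s0)) => // y _.
  apply: (derive_le0_le (df := s0)) => // y /andP[_ y0].
  by rewrite /s0 /flat ltNge (ltW y0)/= mul0r.
- move=> x x1; suff -> : F x = F 1 by rewrite divff// gt_eqF.
  apply/eqP; rewrite eq_le; apply/andP; split.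
    apply: (derive_le0_le (df := s0)) => // y /andP[y1 _].
    by rewrite /s0 {2}/flat ifF ?mulr0//; apply/negbTE; rewrite -leNgt; lra.
  by apply: (derive_ge0_le (df := s0)).
- by move=> x; rewrite mulr_ge0// invr_ge0 ltW.
Qed.

(** [P] is a smoothed Heaviside function rising on [a, a + d]; its density [p] approximates a Dirac
    mass at [a]. *)
Lemma bump a d : 0 < d -> exists P p : R -> R,
  [/\ forall x, is_derive x 1 P (p x), forall n, Ck n p,
      forall x, x <= a -> P x = 0, forall x, a + d <= x -> P x = 1 & forall x, 0 <= p x].
Proof.
move=> d0; have [S [s [dS Cs S0 S1 s0]]] := smooth_step.
have d'0 : 0 < d^-1 by rewrite invr_gt0.
have E x : d^-1 * x + - a / d = (x - a) / d by rewrite mulrDl mulrC.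
exists (fun x => S (d^-1 * x + - a / d)), (fun x => s (d^-1 * x + - a / d) * d^-1); split.
- by move=> x; exact: is_derive_affine.
- by move=> n; apply: CkM; [exact: Ck_affine|exact: Ck_cst].
- by move=> x xa; rewrite S0// E mulr_le0_ge0 ?subr_le0// ltW.
- by move=> x xa; rewrite S1// E ler_pdivlMr// mul1r lerBrDl.
- by move=> x; rewrite mulr_ge0// ltW.
Qed.

Lemma bump_range (P p : R -> R) a d : (forall x, is_derive x 1 P (p x)) -> 0 < d ->
  (forall x, x <= a -> P x = 0) -> (forall x, a + d <= x -> P x = 1) ->
  (forall x, 0 <= p x) -> forall x, 0 <= P x <= 1.
Proof.
move=> dP d0 P0 P1 p0 x; have mono y z : y <= z -> P y <= P z.
  by move=> yz; apply: (derive_ge0_le (df := p)).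
case: (leP x a) => [xa|/ltW xa]; first by rewrite P0// lexx ler01.
rewrite -{1}(P0 _ (lexx a)) mono//=.
case: (leP (a + d) x) => [xa'|/ltW xa']; first by rewrite P1.
by rewrite -(P1 _ (lexx (a + d))) mono.
Qed.

End Smooth.

(** * Integrals over the line *)

Section Integrals.
Context {R : realType}.
Notation mu := (@lebesgue_measure R).
Implicit Types (f g F G phi : R -> R) (a b c d e x y M : R).

Definition integrableR f := mu.-integrable setT (EFin \o f).

Lemma integrableR_measurable f : integrableR f -> measurable_fun setT f.
Proof. by move=> /integrableP[/measurable_EFinP]. Qed.

Lemma integrableRD f g : integrableR f -> integrableR g ->
  integrableR (fun x => f x + g x).
Proof. by move=> hf hg; exact: (integrableD measurableT hf hg). Qed.

Lemma integrableRB f g : integrableR f -> integrableR g ->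
  integrableR (fun x => f x - g x).
Proof. by move=> hf hg; exact: (integrableB measurableT hf hg). Qed.

Lemma integrableRZ c f : integrableR f -> integrableR (fun x => c * f x).
Proof. by move=> hf; exact: (integrableZl measurableT c hf). Qed.

Lemma RintD f g : integrableR f -> integrableR g ->
  \int[mu]_x (f x + g x) = \int[mu]_x f x + \int[mu]_x g x.
Proof. by move=> hf hg; exact: RintegralD. Qed.

Lemma RintB f g : integrableR f -> integrableR g ->
  \int[mu]_x (f x - g x) = \int[mu]_x f x - \int[mu]_x g x.
Proof. by move=> hf hg; exact: RintegralB. Qed.

Lemma RintZ c f : integrableR f -> \int[mu]_x (c * f x) = c * \int[mu]_x f x.
Proof. by move=> hf; exact: RintegralZl. Qed.

Lemma Rint_ge0 f : (forall x, 0 <= f x) -> 0 <= \int[mu]_x f x.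
Proof. by move=> h; exact: Rintegral_ge0. Qed.

Lemma le_Rint f g : integrableR f -> integrableR g -> (forall x, f x <= g x) ->
  \int[mu]_x f x <= \int[mu]_x g x.
Proof. by move=> hf hg h; apply: le_Rintegral. Qed.

Lemma eq_Rint f g : (forall x, f x = g x) -> \int[mu]_x f x = \int[mu]_x g x.
Proof. by move=> h; apply: eq_Rintegral => x _; exact: h. Qed.

Lemma le_norm_Rint f : integrableR f -> `|\int[mu]_x f x| <= \int[mu]_x `|f x|.
Proof. by move=> hf; exact: le_normr_Rintegral. Qed.

Lemma integrableR_norm f : integrableR f -> integrableR (fun x => `|f x|).
Proof. by move=> hf; exact: (integrable_norm hf). Qed.

Lemma continuous_segment_integrable f a b : continuous f ->
  mu.-integrable `[a, b] (EFin \o f).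
Proof.
move=> cf; apply: continuous_compact_integrable; first exact: segment_compact.
exact: continuous_subspaceT.
Qed.

Lemma segment_FTC2 f F a b : a <= b -> continuous f ->
  (forall x, is_derive x 1 F (f x)) -> \int[mu]_(x in `[a, b]) f x = F b - F a.
Proof.
rewrite le_eqVlt => /predU1P[->|ab] cf dF.
  by rewrite set_itv1 Rintegral_set1 subrr.
rewrite /Rintegral (@continuous_FTC2 _ f F)//.
- exact: continuous_subspaceT.
- split => [x _||]; first by case: (dF x).
  + by apply: cvg_at_right_filter; exact: is_derive_continuous (dF a).
  + by apply: cvg_at_left_filter; exact: is_derive_continuous (dF b).
- by move=> x _; have /is_derive1P[] := dF x.
Qed.

Lemma supported_patch f M : supported f M -> f \_ `[- M, M] = f.
Proof.
move=> sf; apply/funext => x; rewrite patchE; case: ifPn => //.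
rewrite notin_setE/= in_itv/= -ler_norml => /negP; rewrite -ltNge => /sf ->//.
Qed.

Lemma Rint_supported f M : supported f M ->
  \int[mu]_x f x = \int[mu]_(x in `[- M, M]) f x.
Proof. by move=> sf; rewrite [RHS]Rintegral_mkcond supported_patch. Qed.

Lemma integrable_supported f M : continuous f -> supported f M -> integrableR f.
Proof.
move=> cf sf; rewrite /integrableR -(supported_patch sf) -restrict_EFin.
have h := @integrable_mkcond _ _ R mu `[- M, M] (EFin \o f) (measurable_itv `[- M, M]).
by apply: h.1; exact: continuous_segment_integrable.
Qed.

Lemma Rint_derive_const f F a b M : continuous f ->
  (forall x, is_derive x 1 F (f x)) ->
  (forall x, x <= - M -> F x = a) -> (forall x, M <= x -> F x = b) ->
  supported f M /\ (0 <= M -> \int[mu]_x f x = b - a).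
Proof.
move=> cf dF Fa Fb.
have sf : supported f M.
  move=> x Mx; suff h : is_derive x 1 F 0.
    by have /is_derive1P[_ <-] := dF x; have /is_derive1P[_ <-] := h.
  case: (ltP x 0) Mx => [x0|x0] Mx.
    rewrite ltr0_norm// in Mx; apply: (near_eq_is_derive _ (is_derive1_cst a x)).
    apply/nbhs_dist; exists (- x - M); first by lra.
    by move=> y; rewrite ltr_norml => /andP[_ h]; rewrite Fa//; lra.
  rewrite ger0_norm// in Mx; apply: (near_eq_is_derive _ (is_derive1_cst b x)).
  apply/nbhs_dist; exists (x - M); first by lra.
  by move=> y; rewrite ltr_norml => /andP[h _]; rewrite Fb//; lra.
split=> // M0; rewrite (Rint_supported sf) (@segment_FTC2 _ F)//.
  by rewrite (Fa (- M))// (Fb M).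
by lra.
Qed.

Definition L2 f := f \in Lfun mu 2%:E.

Lemma L2P f : L2 f <-> measurable_fun setT f /\ integrableR (fun x => f x ^+ 2).
Proof.
split=> [h|[mf intf]].
  split; last exact: Lfun2_integrable_sqr.
  by move: h; rewrite /L2 inE => /andP[/[!inE]].
rewrite /L2 inE; apply/andP; split; rewrite inE//=.
rewrite /finite_norm unlock /Lnorm poweR_lty//.
move/integrableP : intf => [_]; apply: le_lt_trans.
apply: ge0_le_integral => //=.
- apply/measurable_EFinP.
  apply: (@measurableT_comp _ _ _ _ _ _ (fun x : R => x `^ 2)%R) => //.
  exact/measurableT_comp.
- apply/measurable_EFinP; apply: measurableT_comp => //.
  by apply: measurable_funM.
- by move=> x _; rewrite lee_fin normrX powR_mulrn.
Qed.

Lemma L2_sqr f : L2 f -> integrableR (fun x => f x ^+ 2).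
Proof. by move=> /L2P[]. Qed.

Lemma L2_measurable f : L2 f -> measurable_fun setT f.
Proof. by move=> /L2P[]. Qed.

Lemma L2M f g : L2 f -> L2 g -> integrableR (fun x => f x * g x).
Proof. by move=> hf hg; apply/Lfun1_integrable; exact: Lfun2_mul_Lfun1. Qed.

Lemma L2D f g : L2 f -> L2 g -> L2 (fun x => f x + g x).
Proof.
move=> hf hg; apply/L2P; split.
  by apply: measurable_funD; exact: L2_measurable.
have -> : (fun x => (f x + g x) ^+ 2) = (fun x => (f x ^+ 2 + 2 * (f x * g x)) + g x ^+ 2).
  by apply/funext => x; ring.
apply: integrableRD (L2_sqr hg); apply: integrableRD (L2_sqr hf) _.
exact/integrableRZ/L2M.
Qed.

Lemma L2Z c f : L2 f -> L2 (fun x => c * f x).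
Proof.
move=> hf; apply/L2P; split.
  by apply: measurable_funM => //; exact: L2_measurable.
have -> : (fun x => (c * f x) ^+ 2) = (fun x => c ^+ 2 * f x ^+ 2).
  by apply/funext => x; rewrite exprMn.
exact/integrableRZ/L2_sqr.
Qed.

Lemma L2B f g : L2 f -> L2 g -> L2 (fun x => f x - g x).
Proof.
move=> hf hg; have -> : (fun x => f x - g x) = (fun x => f x + (-1) * g x).
  by apply/funext => x; ring.
by apply: L2D => //; exact: L2Z.
Qed.

Lemma L2_supported f M : continuous f -> supported f M -> L2 f.
Proof.
move=> cf sf; apply/L2P; split; first exact: continuous_measurable_fun.
apply: (@integrable_supported _ M); last by move=> x /sf ->; rewrite expr0n.
by move=> x; apply: cvgM; exact: cf.
Qed.

Lemma Cauchy_Schwarz_L2 f g : L2 f -> L2 g ->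
  (\int[mu]_x (f x * g x)) ^+ 2 <= \int[mu]_x (f x ^+ 2) * \int[mu]_x (g x ^+ 2).
Proof.
move=> hf hg; set A := \int[mu]_x (f x ^+ 2); set C := \int[mu]_x (g x ^+ 2).
set B := \int[mu]_x (f x * g x).
have hf2 := L2_sqr hf; have hg2 := L2_sqr hg; have hfg := L2M hf hg.
have q t : 0 <= A + (2 * t * B + t ^+ 2 * C).
  have -> : A + (2 * t * B + t ^+ 2 * C) =
      \int[mu]_x (f x ^+ 2 + (2 * t * (f x * g x) + t ^+ 2 * g x ^+ 2)).
    by rewrite RintD ?RintD ?RintZ//; do ?[apply: integrableRD|exact: integrableRZ].
  apply: Rint_ge0 => x; rewrite (_ : _ + _ = (f x + t * g x) ^+ 2) ?sqr_ge0//; ring.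
have A0 : 0 <= A by apply: Rint_ge0 => x; exact: sqr_ge0.
have : 0 <= C by apply: Rint_ge0 => x; exact: sqr_ge0.
rewrite le_eqVlt => /predU1P[C0|C0].
  rewrite -C0 mulr0; have [->|B0] := eqVneq B 0; first by rewrite expr0n.
  (* When C = 0 the quadratic is affine in t, and this t gives it the value -1. For C > 0 the
     minimiser - B / C is used below. *)
  have := q (- (A + 1) / (2 * B)); rewrite -C0 mulr0 addr0.
  rewrite (_ : 2 * _ * B = - (A + 1)); last by field.
  lra.
have := q (- B / C); rewrite (_ : A + _ = (A * C - B ^+ 2) / C); last by field; rewrite gt_eqF.
by rewrite pmulr_lge0 ?invr_gt0// subr_ge0.
Qed.

(** Reflection preserves Lebesgue measure. The change of variables is made for nonnegative functions
    and carried over to the positive and negative parts. *)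
Lemma Rint_oppr f : measurable_fun setT f -> integrableR f ->
  integrableR (fun x => f (- x)) /\ \int[mu]_x f (- x) = \int[mu]_x f x.
Proof.
move=> mf intf.
have mfN : measurable_fun setT (fun x => f (- x)).
  by apply: measurableT_comp => //; exact: oppr_measurable.
have e (g : R -> R) : measurable_fun setT g -> (forall x, 0 <= g x) ->
    (\int[mu]_x (g (- x))%:E = \int[mu]_x (g x)%:E)%E.
  move=> mg g0.
  transitivity (\int[pushforward mu (-%R : _ -> measurableTypeR R)]_x (g x)%:E)%E.
    rewrite ge0_integral_pushforward//; first exact/measurable_EFinP.
    by move=> x _; rewrite lee_fin.
  by apply: eq_measure_integral => //= A mA AS; exact: lebesgue_measureN.
split.
  apply/integrableP; split; first exact/measurable_EFinP.
  move/integrableP : intf => [_]; apply: le_lt_trans.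
  by rewrite (e (fun x => `|f x|))//; exact: measurableT_comp.
rewrite /Rintegral [in LHS]integralE [in RHS]integralE; congr (fine (_ - _)).
  under eq_integral do rewrite funeposE -EFin_max.
  under [RHS]eq_integral do rewrite funeposE -EFin_max.
  rewrite (e (fun x => Num.max (f x) 0))//; first exact: measurable_maxr.
  by move=> x; rewrite le_max lexx orbT.
under eq_integral do rewrite funenegE /= -EFin_max.
under [RHS]eq_integral do rewrite funenegE /= -EFin_max.
rewrite (e (fun x => Num.max (- f x) 0))//.
  by apply: measurable_maxr => //; exact: measurableT_comp.
by move=> x; rewrite le_max lexx orbT.
Qed.

(** The increment of [F] is the integral over [- x, x]; dominated convergence of the truncations of
    [f] applies along every sequence tending to infinity. *)
Lemma Rint_cvg_segments f F : continuous f -> integrableR f ->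
  (forall x, is_derive x 1 F (f x)) ->
  F x - F (- x) @[x --> +oo] --> \int[mu]_x f x.
Proof.
move=> cf intf dF; apply/cvg_pinftyP => u uoo.
have [|||||_ _] := @dominated_convergence _ _ _ mu setT measurableT
  (fun n => EFin \o (f \_ `[- u n, u n])) (EFin \o f) (fun x => (`|f x|)%:E).
- move=> n; rewrite -restrict_EFin; apply/(measurable_restrictT _ _).1 => //.
  by apply: measurable_funTS; apply/measurable_EFinP; exact: continuous_measurable_fun.
- by apply/measurable_EFinP; exact: continuous_measurable_fun.
- apply/nearW => x _; apply: cvg_near_cst; near=> n; rewrite /= patchE ifT//.
  rewrite inE/= in_itv/= -ler_norml.
  by near: n; move/cvgryPge : uoo; apply.
- exact: integrableR_norm.
- apply/nearW => x n _; rewrite /= patchE; case: ifPn => // _; rewrite lee_fin.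
  by rewrite normr0.
have -> : (\int[mu]_x (EFin \o f) x = (\int[mu]_x f x)%:E)%E.
  by rewrite /Rintegral fineK//; exact: integrable_fin_num.
move/fine_cvg; apply: cvg_trans; apply: near_eq_cvg; near=> n => /=.
rewrite -(@segment_FTC2 f F)//; first by rewrite Rintegral_mkcond.
have : 0 <= u n by near: n; move/cvgryPge : uoo; apply.
lra.
Unshelve. all: by end_near. Qed.

End Integrals.

(** * Weak derivatives of continuous functions *)

Section Distributions.
Context {R : realType}.
Notation mu := (@lebesgue_measure R).
Implicit Types (f g F G phi v w : R -> R) (a b c d e x y M : R).

Lemma continuousMfun f g : continuous f -> continuous g ->
  continuous (fun x => f x * g x).
Proof. by move=> cf cg x; apply: cvgM; [exact: cf|exact: cg]. Qed.

Lemma continuousBfun f g : continuous f -> continuous g ->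
  continuous (fun x => f x - g x).
Proof. by move=> cf cg x; apply: cvgB; [exact: cf|exact: cg]. Qed.

Lemma test_function_integrable f phi : continuous f -> test_function phi ->
  integrableR (fun x => f x * phi x).
Proof.
move=> cf tphi; have [_ [M sphi]] := (test_functionP phi).1 tphi.
apply: (@integrable_supported _ _ M).
  by apply: continuousMfun => //; exact: test_function_continuous.
by move=> x /sphi ->; rewrite mulr0.
Qed.

Lemma test_function_L2 phi : test_function phi -> L2 phi.
Proof.
move=> tphi; have [_ [M sphi]] := (test_functionP phi).1 tphi.
by apply: L2_supported sphi; exact: test_function_continuous.
Qed.

Lemma derive1_test phi phi' : (forall x, is_derive x 1 phi (phi' x)) ->
  derive1 phi = phi'.
Proof. by move=> d; apply/funext => x; have /is_derive1P[] := d x. Qed.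

Lemma bump_test (P p : R -> R) a d : 0 < d -> (forall x, is_derive x 1 P (p x)) ->
  (forall n, Ck n p) -> (forall x, x <= a -> P x = 0) ->
  (forall x, a + d <= x -> P x = 1) ->
  [/\ test_function p, \int[mu]_x p x = 1 & forall x, ~~ (a <= x <= a + d) -> p x = 0].
Proof.
move=> d0 dP Cp P0 P1; have na : - a <= `|a| by rewrite -normrN ler_norm.
have [sp ip] := @Rint_derive_const _ p P 0 1 (`|a| + d) (Cp 0%N) dP
  (fun x (h : x <= - (`|a| + d)) => P0 x ltac:(lra))
  (fun x (h : `|a| + d <= x) => P1 x ltac:(have := ler_norm a; lra)).
split.
- by apply/test_functionP; split=> //; exists (`|a| + d).
- by rewrite ip ?subr0// addr_ge0// ltW.
- move=> x xa; suff h : is_derive x 1 P 0.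
    by have /is_derive1P[_ <-] := dP x; have /is_derive1P[_ <-] := h.
  case: (ltP x a) xa => [xa _|xa /=]; last rewrite -ltNge => xd.
    apply: (near_eq_is_derive _ (is_derive1_cst 0 x)).
    apply/nbhs_dist; exists (a - x); first by lra.
    by move=> y; rewrite ltr_norml => /andP[_ h]; rewrite P0//; lra.
  apply: (near_eq_is_derive _ (is_derive1_cst 1 x)).
  apply/nbhs_dist; exists (x - (a + d)); first by lra.
  by move=> y; rewrite ltr_norml => /andP[h _]; rewrite P1//; lra.
Qed.

Lemma bump_average (P p : R -> R) a d w m e : 0 < d ->
  (forall x, is_derive x 1 P (p x)) ->
  (forall n, Ck n p) -> (forall x, x <= a -> P x = 0) ->
  (forall x, a + d <= x -> P x = 1) -> (forall x, 0 <= p x) ->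
  continuous w -> (forall x, a <= x <= a + d -> `|w x - m| <= e) ->
  `|\int[mu]_x (w x * p x) - m| <= e.
Proof.
move=> d0 dP Cp P0 P1 p0 cw hw.
have [tp ip pout] := bump_test d0 dP Cp P0 P1.
have intp (k : R) : integrableR (fun x => k * p x).
  by apply: (test_function_integrable (f := fun=> k)) => //; exact: cst_continuous.
have intp1 : integrableR p.
  by have := intp 1; congr integrableR; apply/funext => x; rewrite mul1r.
have intw : integrableR (fun x => w x * p x) by exact: test_function_integrable.
have -> : \int[mu]_x (w x * p x) - m = \int[mu]_x (w x * p x - m * p x).
  by rewrite RintB// RintZ// ip mulr1.
apply: le_trans (le_norm_Rint (integrableRB intw (intp m))) _.
have -> : e = \int[mu]_x (e * p x) by rewrite RintZ// ip mulr1.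
apply: le_Rint => //; first exact/integrableR_norm/integrableRB.
move=> x; rewrite -mulrBl normrM (ger0_norm (p0 x)).
case: (boolP (a <= x <= a + d)) => [/hw h|/pout ->]; last by rewrite !mulr0.
by rewrite ler_wpM2r.
Qed.

(** The extra bound of the width by [e] controls the length of the transition zone of a plateau in
    [weak_derivative_Hoelder]. *)
Lemma continuous_modulus w a e : continuous w -> 0 < e ->
  exists2 d, 0 < d <= e & forall x, a <= x <= a + d -> `|w x - w a| <= e.
Proof.
move=> cw e0; have /continuousP_dist/(_ _ e0)[d d0 hd] := cw a.
exists (Num.min (d / 2) e); first by rewrite lt_min divr_gt0// e0 ge_min lexx orbT.
move=> x /andP[ax xd]; apply/ltW/hd; rewrite ger0_norm ?subr_ge0//.
have : Num.min (d / 2) e <= d / 2 by rewrite ge_min lexx.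
lra.
Qed.

Lemma continuous_modulus2 w a b e : continuous w -> 0 < e ->
  exists d, [/\ 0 < d, d <= e, forall x, a <= x <= a + d -> `|w x - w a| <= e &
    forall x, b <= x <= b + d -> `|w x - w b| <= e].
Proof.
move=> cw e0.
have [d1 /andP[d10 d1e] h1] := continuous_modulus a cw e0.
have [d2 /andP[d20 d2e] h2] := continuous_modulus b cw e0.
exists (Num.min d1 d2); split.
- by rewrite lt_min d10.
- by rewrite ge_min d1e.
- move=> x /andP[ax xd]; apply: h1; rewrite ax (le_trans xd)// lerD2l.
  by rewrite ge_min lexx.
- move=> x /andP[ax xd]; apply: h2; rewrite ax (le_trans xd)// lerD2l.
  by rewrite ge_min lexx orbT.
Qed.

(** A smooth substitute for the indicator function of [a, b]: the difference of two steps rising at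
    [a] and at [b]. Its derivative is close to the difference of the Dirac masses at [a] and [b], so
    testing with it reads off w a - w b, with an error [e] at each end. *)
Lemma plateau a b d : 0 < d -> a <= b -> exists phi pa pb : R -> R,
  [/\ test_function phi, forall x, is_derive x 1 phi (pa x - pb x),
    forall x, `|phi x| <= 1, forall x, ~~ (a <= x <= b + d) -> phi x = 0 &
    forall w e, continuous w -> 
     (forall x, a <= x <= a + d -> `|w x - w a| <= e) ->
     (forall x, b <= x <= b + d -> `|w x - w b| <= e) ->
     `|(w a - w b) - \int[mu]_x (w x * (pa x - pb x))| <= 2 * e].
Proof.
move=> d0 ab; have [Pa [pa [dPa Cpa Pa0 Pa1 pa0]]] := bump a d0.
have [Pb [pb [dPb Cpb Pb0 Pb1 pb0]]] := bump b d0.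
have ra := bump_range dPa d0 Pa0 Pa1 pa0; have rb := bump_range dPb d0 Pb0 Pb1 pb0.
have out x : ~~ (a <= x <= b + d) -> Pa x - Pb x = 0.
  rewrite negb_and -!ltNge => /orP[xa|xb].
    by rewrite Pa0 ?Pb0 ?subr0// ltW// (lt_le_trans xa).
  by rewrite Pa1 ?Pb1 ?subrr//; lra.
exists (fun x => Pa x - Pb x), pa, pb; split => //.
- apply/test_functionP; split.
    move=> n; apply: (@Ck_pred _ n); exists (fun x => pa x + (-1) * pb x).
      move=> x; apply: is_derive_eq (is_deriveB1 (dPa x) (dPb x)) _; ring.
    by apply: CkD => //; apply: CkM => //; exact: Ck_cst.
  exists (`|a| + `|b| + d) => x xM; apply: out; apply/negP => /andP[xa xb].
  have h1 := ler_norm b; have h2 : - `|a| <= a by rewrite lerNl -normrN ler_norm.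
  have h3 : 0 <= `|a| by []. have h4 : 0 <= `|b| by [].
  by move: xM; rewrite ltNge => /negP; apply; rewrite ler_norml; apply/andP; split; lra.
- by move=> x; exact: is_deriveB1.
- by move=> x; have := ra x; have := rb x; rewrite ler_norml; lra.
- move=> w e cw ha hb.
  have A := bump_average d0 dPa Cpa Pa0 Pa1 pa0 cw ha.
  have B := bump_average d0 dPb Cpb Pb0 Pb1 pb0 cw hb.
  have [ta _ _] := bump_test d0 dPa Cpa Pa0 Pa1.
  have [tb _ _] := bump_test d0 dPb Cpb Pb0 Pb1.
  under eq_Rint do rewrite mulrBr.
  rewrite RintB; [|exact: test_function_integrable..].
  by move: A B; rewrite !ler_norml; lra.
Qed.

(** The du Bois-Reymond lemma, by testing with plateaus from [a] to [b] of vanishing transition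
    width. *)
Lemma weak_derivative0_cst w : continuous w ->
  (forall phi, test_function phi -> \int[mu]_x (w x * derive1 phi x) = 0) ->
  forall a b, w a = w b.
Proof.
move=> cw hw; suff H a b : a <= b -> w a = w b.
  by move=> a b; case: (leP a b) => [/H//|/ltW/H].
move=> ab; apply/eqP; rewrite -subr_eq0 -normr_le0; apply/ler_addgt0Pr => e e0.
have e20 : 0 < e / 2 by rewrite divr_gt0.
have [d [d0 _ ha hb]] := continuous_modulus2 a b cw e20.
have [phi [pa [pb [tphi dphi _ _ h]]]] := plateau d0 ab.
have := h _ _ cw ha hb; have := hw _ tphi; rewrite (derive1_test dphi) => ->.
by rewrite subr0 add0r; lra.
Qed.

Lemma Rint_by_parts F f phi : continuous f -> (forall x, is_derive x 1 F (f x)) ->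
  test_function phi ->
  \int[mu]_x (f x * phi x) = - \int[mu]_x (F x * derive1 phi x).
Proof.
move=> cf dF tphi; have dphi := test_function_is_derive tphi.
have tphi' := test_function_derive dphi tphi.
have [_ [M sphi]] := (test_functionP phi).1 tphi.
have cF : continuous F := derivable_eq_continuous dF.
have i1 := test_function_integrable cf tphi.
have i2 := test_function_integrable cF tphi'.
apply/eqP; rewrite -addr_eq0 -RintD//; apply/eqP.
have sM x : `|M| + 1 <= `|x| -> phi x = 0.
  by move=> xM; apply: sphi; have := ler_norm M; lra.
have cG : continuous (fun x => f x * phi x + F x * derive1 phi x).
  move=> x; apply: cvgD; apply: continuousMfun => //; exact: test_function_continuous.
have dG x : is_derive x 1 (fun x => F x * phi x) (f x * phi x + F x * derive1 phi x).
  exact: is_deriveM1.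
have [_ ->] := Rint_derive_const cG dG
  (fun x (h : x <= - (`|M| + 1)) => etrans (congr1 (fun z => F x * z)
     (sM x ltac:(by rewrite ler_normr lerNr h orbT))) (mulr0 _))
  (fun x (h : `|M| + 1 <= x) => etrans (congr1 (fun z => F x * z)
     (sM x ltac:(by rewrite ler_normr h))) (mulr0 _)).
  by rewrite subrr.
by rewrite addr_ge0.
Qed.

Lemma weak_derivative_C1 v w : continuous v -> continuous w ->
  (forall phi, test_function phi ->
    \int[mu]_x (v x * derive1 phi x) = - \int[mu]_x (w x * phi x)) ->
  forall x, is_derive x 1 v (w x).
Proof.
move=> cv cw h; have [F dF _] := continuous_primitive cw.
have cF : continuous F := derivable_eq_continuous dF.
have e : forall a b, v a - F a = v b - F b.
  apply: (@weak_derivative0_cst (fun x => v x - F x)).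
    exact: continuousBfun.
  move=> phi tphi; under eq_Rint do rewrite mulrBl.
  have tphi' := test_function_derive (test_function_is_derive tphi) tphi.
  rewrite RintB ?h//; [|exact: test_function_integrable..].
  by rewrite (Rint_by_parts cw dF tphi) opprK subrr.
have -> : v = (fun x => F x + (v 0 - F 0)).
  by apply/funext => x; rewrite (e 0 x); ring.
by move=> x; apply: is_derive_eq (is_deriveD1 (dF x) (is_derive1_cst _ x)) _; rewrite addr0.
Qed.

(** The derivative of [v] must be [W - K] for a primitive [W] of [w] and some constant [K]. A test
    function psi is the derivative of another one only if its integral c vanishes; removing c times
    a fixed bump [p] of integral 1 achieves this, and the terms with [p] determine [K]. *)
Lemma weak_derivative_C2 v w : continuous v -> continuous w ->
  (forall phi, test_function phi ->
    \int[mu]_x (v x * derive1n 2 phi x) = \int[mu]_x (w x * phi x)) ->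
  exists v' : R -> R, (forall x, is_derive x 1 v (v' x)) /\ forall x, is_derive x 1 v' (w x).
Proof.
move=> cv cw h; have [W dW _] := continuous_primitive cw.
have cW : continuous W := derivable_eq_continuous dW.
have [P [p [dP Cp P0 P1 p0]]] := bump 0 (@ltr01 R).
have [tp ip _] := bump_test ltr01 dP Cp P0 P1.
have dp := test_function_is_derive tp; have tp' := test_function_derive dp tp.
(* The only value for which [W - K] passes the test against [p] itself. *)
pose K := \int[mu]_x (W x * p x) + \int[mu]_x (v x * derive1 p x).
exists (fun x => W x - K); split; last first.
  by move=> x; apply: is_derive_eq (is_deriveB1 (dW x) (is_derive1_cst _ x)) _; rewrite subr0.
have cWK : continuous (fun x => W x - K).
  by apply: continuousBfun => //; exact: cst_continuous.
apply: weak_derivative_C1 => // psi tpsi.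
have [Cpsi [M0 spsi0]] := (test_functionP psi).1 tpsi.
pose M := `|M0| + 1.
have M1 : 1 <= M by rewrite lerDr.
have spsi x : M <= `|x| -> psi x = 0.
  by move=> xM; apply: spsi0; apply: lt_le_trans xM; rewrite ltr_pwDr// ler_norm.
have dpsi := test_function_is_derive tpsi; have tpsi' := test_function_derive dpsi tpsi.
have [Q0 dQ0 _] := continuous_primitive (Cpsi 0%N).
pose Q x := Q0 x - Q0 (- M).
have dQ x : is_derive x 1 Q (psi x).
  by apply: is_derive_eq (is_deriveB1 (dQ0 x) (is_derive1_cst _ x)) _; rewrite subr0.
pose c := Q M.
have QN x : x <= - M -> Q x = 0.
  move=> xM; rewrite /Q; suff -> : Q0 x = Q0 (- M) by rewrite subrr.
  have psi0 y : x <= y <= - M -> psi y = 0.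
    by move=> /andP[_ yM]; apply: spsi; rewrite ler_normr lerNr yM orbT.
  apply/eqP; rewrite eq_le; apply/andP; split.
    apply: (derive_ge0_le (df := psi)) => // y /andP[/ltW ? /ltW ?].
    by rewrite psi0//; apply/andP.
  apply: (derive_le0_le (df := psi)) => // y /andP[/ltW ? /ltW ?].
  by rewrite psi0//; apply/andP.
have QM x : M <= x -> Q x = c.
  move=> xM; rewrite /c /Q; suff -> : Q0 x = Q0 M by [].
  have psi0 y : M <= y <= x -> psi y = 0.
    by move=> /andP[yM _]; apply: spsi; rewrite ler_normr yM.
  apply/eqP; rewrite eq_le; apply/andP; split.
    apply: (derive_le0_le (df := psi)) => // y /andP[/ltW ? /ltW ?].
    by rewrite psi0//; apply/andP.
  apply: (derive_ge0_le (df := psi)) => // y /andP[/ltW ? /ltW ?].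
  by rewrite psi0//; apply/andP.
have [_ ic] := Rint_derive_const (Cpsi 0%N) dQ QN QM.
have {}ic : \int[mu]_x psi x = c by rewrite ic ?subr0//; lra.
(* Both [Q] and [c P] are 0 far to the left and equal to c far to the right, so the difference has
   compact support; its derivative is psi - c p. *)
pose phi x := Q x - c * P x.
have dphi x : is_derive x 1 phi (psi x - c * p x).
  apply: is_derive_eq (is_deriveB1 (dQ x) (is_deriveM1 (is_derive1_cst c x) (dP x))) _.
  by rewrite mul0r add0r.
have dphi' x : is_derive x 1 (fun x => psi x - c * p x) (derive1 psi x - c * derive1 p x).
  apply: is_derive_eq (is_deriveB1 (dpsi x) (is_deriveM1 (is_derive1_cst c x) (dp x))) _.
  by rewrite mul0r add0r.
have tphi : test_function phi.
  apply/test_functionP; split.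
    move=> n; apply: (@Ck_pred _ n); exists (fun x => psi x + (- c) * p x).
      by move=> x; apply: is_derive_eq (dphi x) _; ring.
    by apply: CkD => //; apply: CkM => //; exact: Ck_cst.
  exists M => x; rewrite lter_normr => /orP[xM|xM].
    by rewrite /phi QM ?ltW// P1; [ring|lra].
  by rewrite /phi QN; [rewrite P0; [ring|lra]|lra].
have := h _ tphi.
have -> : derive1n 2 phi = (fun x => derive1 psi x - c * derive1 p x).
  by rewrite /derive1n/= (derive1_test dphi) (derive1_test dphi').
rewrite (Rint_by_parts cw dW tphi) (derive1_test dphi).
have iW q : test_function q -> integrableR (fun x => W x * q x) by exact: test_function_integrable.
have iv q : test_function q -> integrableR (fun x => v x * q x) by exact: test_function_integrable.
have e1 : \int[mu]_x (v x * (derive1 psi x - c * derive1 p x)) =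
    \int[mu]_x (v x * derive1 psi x) - c * \int[mu]_x (v x * derive1 p x).
  rewrite -RintZ; last exact: iv.
  rewrite -RintB; [|exact: iv|exact/integrableRZ/iv].
  by apply: eq_Rint => x; ring.
have e2 : \int[mu]_x (W x * (psi x - c * p x)) =
    \int[mu]_x (W x * psi x) - c * \int[mu]_x (W x * p x).
  rewrite -RintZ; last exact: iW.
  rewrite -RintB; [|exact: iW|exact/integrableRZ/iW].
  by apply: eq_Rint => x; ring.
have e3 : \int[mu]_x ((W x - K) * psi x) = \int[mu]_x (W x * psi x) - K * c.
  rewrite -ic -RintZ; last first.
    have := test_function_integrable (@cst_continuous _ _ (1 : R)) tpsi.
    by congr integrableR; apply/funext => x; rewrite mul1r.
  rewrite -RintB; [|exact: iW|].
    by apply: eq_Rint => x; ring.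
  exact: (test_function_integrable (@cst_continuous _ _ K) tpsi).
rewrite e1 e2 e3 /K => E; rewrite -[LHS](subrK (c * \int[mu]_x (v x * derive1 p x))) E.
ring.
Qed.

End Distributions.

(** * Composition of a C^1 function of two variables with a function of one variable *)

Section TwoVariables.
Context {R : realType}.
Implicit Types (g : R -> R -> R) (u v w phi : R -> R) (a b c d e x y s t : R).

Lemma mean_value_between (f df : R -> R) x y : (forall z : R, is_derive z 1 f (df z)) ->
  exists2 z, Num.min x y <= z <= Num.max x y & f y - f x = df z * (y - x).
Proof.
move=> hf; case: (ltgtP x y) => [xy|yx|->].
- have [z /andP[xz zy] e] := mean_value xy (fun t _ => hf t).
  by exists z => //; rewrite !ltW.
- have [z /andP[xz zy] e] := mean_value yx (fun t _ => hf t).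
  by exists z; [rewrite !ltW|rewrite -opprB e -mulrN opprB].
- by exists y; rewrite ?lexx// !subrr mulr0.
Qed.

Lemma between_dist x y z : Num.min x y <= z <= Num.max x y -> `|z - x| <= `|y - x|.
Proof.
by rewrite ler_norml; case: (lerP x y) => xy /andP[h1 h2]; apply/andP; split; lra.
Qed.

Lemma continuous2P_dist (k : R * R -> R) x s : {for (x, s), continuous k} ->
  forall e, 0 < e -> exists2 d, 0 < d &
    forall y t, `|y - x| < d -> `|t - s| < d -> `|k (y, t) - k (x, s)| < e.
Proof.
move=> /cvgrPdist_lt h e /h /nbhs_ballP[d /= d0 hd].
exists d => // y t yx ts; rewrite distrC; apply: (hd (y, t)).
by split; rewrite /ball/= distrC.
Qed.

Section Fixed.
Context (g : R -> R -> R) (hg : C1_plane g).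

Lemma is_derive_pd1 x s : is_derive x 1 (g^~ s) (pd1 g x s).
Proof. by case: hg => h _ _ _; exact: derivable_is_derive. Qed.

Lemma is_derive_pd2 x s : is_derive s 1 (g x) (pd2 g x s).
Proof. by case: hg => _ h _ _; exact: derivable_is_derive. Qed.

(** [C1_plane] provides partial derivatives and their joint continuity. The increment in the first
    variable is taken while the second argument u y moves with it; the mean value theorem and joint
    continuity of [pd1] give the limit of the quotient, with [u] merely continuous. *)
Lemma is_derive_slice u x : {for x, continuous u} ->
  is_derive x 1 (fun y => g y (u y) - g x (u y)) (pd1 g x (u x)).
Proof.
move=> cu; apply/is_derive1_caratheodory.
exists (fun z => if z == x then pd1 g x (u x) else (g z (u z) - g x (u z)) / (z - x)); split.
- move=> z; case: eqVneq => [->|zx]; first by rewrite !subrr mulr0.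
  by rewrite subrr subr0 divfK// subr_eq0.
- case: hg => _ _ c1 _; apply/continuousP_dist => e e0; rewrite eqxx.
  have [d d0 hd] := continuous2P_dist (c1 (x, u x)) e0.
  have /continuousP_dist/(_ _ d0)[d' d'0 hd'] := cu.
  exists (Num.min d d'); first by rewrite lt_min d0.
  move=> z; rewrite lt_min => /andP[zd zd'].
  case: eqVneq => [_|zx]; first by rewrite subrr normr0.
  have [y /between_dist xy ->] := mean_value_between x z (is_derive_pd1^~ (u z)).
  rewrite mulfK ?subr_eq0//; apply: hd; last exact: hd'.
  exact: le_lt_trans xy zd.
- by rewrite eqxx.
Qed.

Lemma is_derive_chain2 u x a : is_derive x 1 u a ->
  is_derive x 1 (fun y => g y (u y)) (pd1 g x (u x) + pd2 g x (u x) * a).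
Proof.
move=> du; have cu := is_derive_continuous du.
have -> : (fun y => g y (u y)) = (fun y => (g y (u y) - g x (u y)) + g x (u y)).
  by apply/funext => y; rewrite subrK.
apply: is_deriveD1; first exact: is_derive_slice.
by apply: is_derive_comp1 => //; exact: is_derive_pd2.
Qed.

Lemma continuous_chain2 u : continuous u -> continuous (fun y => g y (u y)).
Proof.
move=> cu x.
have -> : (fun y => g y (u y)) = (fun y => (g y (u y) - g x (u y)) + g x (u y)).
  by apply/funext => y; rewrite subrK.
apply: cvgD; first exact: (is_derive_continuous (is_derive_slice (cu x))).
apply: continuous_comp; first exact: cu.
exact: is_derive_continuous (is_derive_pd2 _ _).
Qed.

Lemma continuous_pd2_comp u : continuous u -> continuous (fun y => pd2 g y (u y)).
Proof.
move=> cu x; case: hg => _ _ _ c2; apply/continuousP_dist => e e0.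
have [d d0 hd] := continuous2P_dist (c2 (x, u x)) e0.
have /continuousP_dist/(_ _ d0)[d' d'0 hd'] := cu x.
exists (Num.min d d'); first by rewrite lt_min d0.
by move=> z; rewrite lt_min => /andP[zd /hd' zd']; exact: hd.
Qed.

End Fixed.

End TwoVariables.

(** * Sobolev estimates *)

Section Sobolev.
Context {R : realType}.
Notation mu := (@lebesgue_measure R).
Implicit Types (f g u v w phi : R -> R) (a b c d e x y s t : R).

(** Testing with a plateau turns v a - v b, up to a small error, into minus the integral of w phi.
    Cauchy-Schwarz applies, and the integral of phi^2 is at most the length b - a + d of a segment
    carrying phi. *)
Lemma weak_derivative_Hoelder v w a b : continuous v -> L2 w ->
  is_weak_derivative v w -> a <= b ->
  (v b - v a) ^+ 2 <= \int[mu]_x (w x ^+ 2) * (b - a).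
Proof.
move=> cv lw hw ab; set W := \int[mu]_x (w x ^+ 2).
have W0 : 0 <= W by apply: Rint_ge0 => x; exact: sqr_ge0.
have key e : 0 < e -> exists2 I, `|(v a - v b) - I| <= 2 * e & I ^+ 2 <= W * (b - a + e).
  move=> e0; have [d [d0 de ha hb]] := continuous_modulus2 a b cv e0.
  have [phi [pa [pb [tphi dphi phi1 phi0 h]]]] := plateau d0 ab.
  exists (\int[mu]_x (v x * (pa x - pb x))); first exact: h.
  have -> : \int[mu]_x (v x * (pa x - pb x)) = \int[mu]_x (v x * derive1 phi x).
    by rewrite (derive1_test dphi).
  rewrite hw// sqrrN.
  apply: le_trans (Cauchy_Schwarz_L2 lw (test_function_L2 tphi)) _.
  rewrite ler_wpM2l//; apply: (@le_trans _ _ (b - a + d)); last by rewrite lerD2l.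
  have cphi := test_function_continuous tphi.
  have abd : a <= b + d by lra.
  have out x : ~~ (a <= x <= b + d) -> phi x ^+ 2 = 0 by move=> /phi0 ->; rewrite expr0n.
  have -> : \int[mu]_x (phi x ^+ 2) = \int[mu]_(x in `[a, b + d]) (phi x ^+ 2).
    rewrite [RHS]Rintegral_mkcond; apply: eq_Rint => x; rewrite patchE.
    by case: ifPn => //; rewrite notin_setE/= in_itv/= => /negP/out.
  have c2 : continuous (fun x => phi x ^+ 2) by exact: continuousMfun.
  apply: (@le_trans _ _ (\int[mu]_(x in `[a, b + d]) 1)).
    apply: le_Rintegral => //; first exact: continuous_segment_integrable.
      exact: (continuous_segment_integrable _ _ (@cst_continuous _ _ (1 : R))).
    by move=> x _; rewrite -real_normK ?num_real// exprn_ile1.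
  rewrite (segment_FTC2 abd (@cst_continuous _ _ (1 : R)) (fun x => is_derive1_id x)).
  by rewrite addrAC.
set A := `|v b - v a|; have A0 : 0 <= A by exact: normr_ge0.
rewrite -real_normK ?num_real// -/A.
apply/ler_addgt0Pr => e e0.
(* The total error is at most W k from the length of the segment plus 4 A k from squaring A <= |I| +
   2 k. *)
pose k := e / (W + 4 * A + 1).
have k1 : 0 < W + 4 * A + 1 by lra.
have kp : 0 < k by rewrite divr_gt0.
have [I h1 h2] := key k kp.
have AI : A <= `|I| + 2 * k.
  rewrite /A distrC -(subrK I (v a - v b)) addrC.
  by apply: le_trans (ler_normD _ _) _; rewrite lerD2l.
have II : `|I| ^+ 2 = I ^+ 2 by rewrite real_normK ?num_real.
have ek : k * (W + 4 * A + 1) = e by rewrite /k divfK// gt_eqF.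
have I0 : 0 <= `|I| by [].
have : A ^+ 2 <= `|I| ^+ 2 + 4 * A * k.
  case: (leP A (2 * k)) => Ak; first by nra.
  have : (A - 2 * k) ^+ 2 <= `|I| ^+ 2 by apply: lerXn2r; rewrite ?nnegrE//; lra.
  by nra.
by rewrite II; nra.
Qed.

Lemma L2_integral_segment v a b : continuous v -> L2 v -> a <= b ->
  \int[mu]_(x in `[a, b]) (v x ^+ 2) <= \int[mu]_x (v x ^+ 2).
Proof.
move=> cv lv ab; have c2 : continuous (fun x => v x ^+ 2) by exact: continuousMfun.
rewrite [leLHS]Rintegral_mkcond; apply: le_Rint.
- have h := @integrable_mkcond _ _ R mu `[a, b] (EFin \o (fun x => v x ^+ 2)) (measurable_itv `[a, b]).
  rewrite /integrableR -restrict_EFin; apply: h.1.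
  exact: continuous_segment_integrable.
- exact: L2_sqr.
- by move=> x; rewrite patchE; case: ifPn => // _; exact: sqr_ge0.
Qed.

(** Some z in [x, x + 1] has v(z)^2 equal to the mean of v^2 there, and v(x) differs from v(z) by at
    most the square root of W. *)
Lemma Hoelder_sup_bound v W x : continuous v -> L2 v ->
  (forall a b, a <= b -> (v b - v a) ^+ 2 <= W * (b - a)) ->
  v x ^+ 2 <= 2 * (\int[mu]_x (v x ^+ 2) + W).
Proof.
move=> cv lv hW; have c2 : continuous (fun x => v x ^+ 2) by exact: continuousMfun.
have [Q dQ _] := continuous_primitive c2.
have x1 : x < x + 1 by rewrite ltrDl.
have [z /andP[xz zx] e] := mean_value x1 (fun t _ => dQ t).
have := L2_integral_segment cv lv (ltW x1); rewrite (segment_FTC2 (ltW x1) c2 dQ) e.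
rewrite addrAC subrr add0r mulr1.
have := hW _ _ (ltW xz); have : 0 <= W.
  by have := hW 0 1 ler01; rewrite subr0 mulr1; apply: le_trans; exact: sqr_ge0.
have := sqr_ge0 (2 * v z - v x); nra.
Qed.

(** A primitive of v^2 is monotone and bounded, hence convergent, so the integral of v^2 over
    [x, x + r] is small for large x. This makes v small at some point of the interval, and the
    Hoelder bound carries it back to x. *)
Lemma Hoelder_decay v W : continuous v -> L2 v ->
  (forall a b, a <= b -> (v b - v a) ^+ 2 <= W * (b - a)) ->
  forall e, 0 < e -> exists M, forall x, M <= x -> `|v x| <= e.
Proof.
move=> cv lv hW e e0; have c2 : continuous (fun x => v x ^+ 2) by exact: continuousMfun.
have [Q dQ _] := continuous_primitive c2.
have W0 : 0 <= W.
  by have := hW 0 1 ler01; rewrite subr0 mulr1; apply: le_trans; exact: sqr_ge0.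
have ndQ : {homo Q : x y / x <= y}.
  by move=> x y xy; apply: (derive_ge0_le (df := fun x => v x ^+ 2)) => // z _; exact: sqr_ge0.
(* Over a length r the function varies by at most e / 2; the other half of e is the size of v at the
   intermediate point. *)
pose r := e ^+ 2 / (4 * (W + 1)).
have r0 : 0 < r by rewrite divr_gt0 ?exprn_gt0//; lra.
have ubQ : has_ubound (range Q).
  exists (Q 0 + \int[mu]_x (v x ^+ 2)) => _ [x _ <-].
  rewrite -lerBlDl; case: (leP 0 x) => [x0|/ltW x0].
    by rewrite -(segment_FTC2 x0 c2 dQ); exact: L2_integral_segment.
  apply: (@le_trans _ _ 0); first by rewrite subr_le0 ndQ.
  by apply: Rint_ge0 => y; exact: sqr_ge0.
have /cvgrPdist_lt/(_ (r * e ^+ 2 / 8)) := nondecreasing_cvgr ndQ ubQ.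
set L := sup _ => h.
have re : 0 < r * e ^+ 2 / 8 by rewrite divr_gt0// mulr_gt0// exprn_gt0.
have [M [_ hM]] := h re; exists (M + 1) => x Mx.
have h1 := hM x ltac:(lra); have h2 := hM (x + r) ltac:(lra).
have [z /andP[xz zx] ez] := mean_value (ltac:(lra) : x < x + r) (fun t _ => dQ t).
have Hz := hW _ _ (ltW xz).
have rW : W * r <= e ^+ 2 / 4.
  rewrite /r mulrA ler_pdivrMr; last lra.
  have := exprn_gt0 2 e0; nra.
have vz : v z ^+ 2 * r <= r * e ^+ 2 / 4.
  move: h1 h2; rewrite !ltr_norml => /andP[h1 h1'] /andP[h2 h2'].
  by move: ez; rewrite (addrAC x r) subrr add0r => <-; lra.
have vz2 : v z ^+ 2 <= e ^+ 2 / 4 by rewrite -(ler_pM2r r0); lra.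
have H2 : (v z - v x) ^+ 2 <= e ^+ 2 / 4.
  apply: le_trans rW; apply: le_trans Hz _; rewrite ler_wpM2l//; lra.
have : `|v x| ^+ 2 <= e ^+ 2.
  rewrite real_normK ?num_real//; have := sqr_ge0 (2 * v z - v x); nra.
by rewrite ler_pXn2r ?nnegrE// ltW.
Qed.

Lemma weak_derivativeP v : H1 v ->
  L2 (weak_derivative v) /\ is_weak_derivative v (weak_derivative v).
Proof.
move=> [_ _ [w lw hw]].
by have := @xgetPex _ (cst 0) [set w | w \in Lfun mu 2%:E /\ is_weak_derivative v w]
  (ex_intro _ w (conj lw hw)).
Qed.

Lemma H1normE v : H1norm v ^+ 2 =
  \int[mu]_x (v x ^+ 2) + \int[mu]_x (weak_derivative v x ^+ 2).
Proof.
rewrite /H1norm sqr_sqrtr// addr_ge0//; apply: Rint_ge0 => x; exact: sqr_ge0.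
Qed.

Lemma H1_Hoelder v : H1 v -> forall a b, a <= b ->
  (v b - v a) ^+ 2 <= \int[mu]_x (weak_derivative v x ^+ 2) * (b - a).
Proof.
move=> Hv a b; have [lw hw] := weak_derivativeP Hv; case: Hv => cv _ _.
exact: weak_derivative_Hoelder.
Qed.

Lemma H1_sup v x : H1 v -> v x ^+ 2 <= 2 * H1norm v ^+ 2.
Proof.
move=> Hv; rewrite H1normE; case: (Hv) => cv lv _.
exact: Hoelder_sup_bound (H1_Hoelder Hv).
Qed.

Lemma H1_L2 v : H1 v -> \int[mu]_x (v x ^+ 2) <= H1norm v ^+ 2.
Proof.
move=> Hv; rewrite H1normE lerDl; apply: Rint_ge0 => x; exact: sqr_ge0.
Qed.

Lemma H1_decay v : H1 v -> forall e, 0 < e -> exists M, forall x, M <= x -> `|v x| <= e.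
Proof. by move=> Hv; case: (Hv) => cv lv _; exact: Hoelder_decay (H1_Hoelder Hv). Qed.

Lemma H1Z c v : H1 v -> H1 (fun x => c * v x).
Proof.
move=> [cv lv [w lw hw]]; split.
- by apply: continuousMfun => //; exact: cst_continuous.
- exact: L2Z.
exists (fun x => c * w x); first exact: L2Z.
move=> phi tphi; have tphi' := test_function_derive (test_function_is_derive tphi) tphi.
under eq_Rint do rewrite -mulrA.
under [in RHS]eq_Rint do rewrite -mulrA.
rewrite !RintZ ?hw ?mulrN//; first exact: L2M (test_function_L2 tphi).
exact: test_function_integrable.
Qed.

Lemma H1B v1 v2 : H1 v1 -> H1 v2 -> H1 (fun x => v1 x - v2 x).
Proof.
move=> [c1 l1 [w1 lw1 hw1]] [c2 l2 [w2 lw2 hw2]]; split.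
- exact: continuousBfun.
- exact: L2B.
exists (fun x => w1 x - w2 x); first exact: L2B.
move=> phi tphi; have tphi' := test_function_derive (test_function_is_derive tphi) tphi.
under eq_Rint do rewrite mulrBl.
under [in RHS]eq_Rint do rewrite mulrBl.
rewrite !RintB ?hw1 ?hw2//; first by rewrite opprB opprK addrC.
- exact: L2M (test_function_L2 tphi).
- exact: L2M (test_function_L2 tphi).
- exact: test_function_integrable.
- exact: test_function_integrable.
Qed.

Lemma L2_oppr v : L2 v -> L2 (fun x => v (- x)).
Proof.
move=> lv; apply/L2P; split.
  by apply: measurableT_comp; [exact: L2_measurable|exact: oppr_measurable].
have [] // := Rint_oppr (f := fun x => v x ^+ 2) _ (L2_sqr lv).
by apply: measurable_funX; exact: L2_measurable.
Qed.

Lemma test_function_oppr phi : test_function phi ->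
  [/\ test_function (fun x => phi (- x)),
      derive1 (fun x => phi (- x)) = (fun x => - derive1 phi (- x)) &
      derive1n 2 (fun x => phi (- x)) = (fun x => derive1n 2 phi (- x))].
Proof.
move=> tphi; have dphi := test_function_is_derive tphi.
have tphi' := test_function_derive dphi tphi.
have dphi' := test_function_is_derive tphi'.
have d1 x : is_derive x 1 (fun x => phi (- x)) (- derive1 phi (- x)).
  apply: is_derive_eq (is_derive_comp1 (dphi (- x)) (is_deriveN1 (is_derive1_id x))) _.
  by rewrite mulrN1.
have d2 x : is_derive x 1 (fun x => - derive1 phi (- x)) (derive1 (derive1 phi) (- x)).
  apply: is_derive_eq (is_deriveN1 (is_derive_comp1 (dphi' (- x)) (is_deriveN1 (is_derive1_id x)))) _.
  by rewrite mulrN1 opprK.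
split.
- have [Cphi [M sphi]] := (test_functionP phi).1 tphi.
  apply/test_functionP; split; last by exists M => x; rewrite -normrN => /sphi.
  move=> n; have := Ck_affine (-1) 0 (Cphi n).
  by congr (Ck n _); apply/funext => x; rewrite mulN1r addr0.
- exact: derive1_test.
- by rewrite /derive1n/= (derive1_test d1) (derive1_test d2).
Qed.

Lemma Rint_oppr_test v phi : continuous v -> test_function phi ->
  \int[mu]_x (v (- x) * phi x) = \int[mu]_x (v x * phi (- x)).
Proof.
move=> cv tphi; have [tN _ _] := test_function_oppr tphi.
have iv := test_function_integrable cv tN.
have [_ <-] := Rint_oppr (integrableR_measurable iv) iv.
by apply: eq_Rint => x; rewrite opprK.
Qed.

Lemma continuous_oppr v : continuous v -> continuous (fun x => v (- x)).
Proof.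
by move=> cv x; apply: continuous_comp; [exact: opp_continuous|exact: cv].
Qed.

Lemma H1_oppr v : H1 v -> H1 (fun x => v (- x)).
Proof.
move=> [cv lv [w lw hw]]; split; [exact: continuous_oppr|exact: L2_oppr|].
exists (fun x => (-1) * w (- x)); first exact/L2Z/L2_oppr.
move=> phi tphi; have [tN dN _] := test_function_oppr tphi.
have tphi' := test_function_derive (test_function_is_derive tphi) tphi.
rewrite Rint_oppr_test//.
have -> : \int[mu]_x (v x * derive1 phi (- x)) =
    - \int[mu]_x (v x * derive1 (fun x => phi (- x)) x).
  rewrite dN; under [in RHS]eq_Rint do rewrite mulrN -mulN1r.
  rewrite RintZ ?mulN1r ?opprK//.
  apply: (@test_function_integrable _ v (fun x => derive1 phi (- x))) => //.
  by have [] := test_function_oppr tphi'.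
rewrite hw// opprK.
have iw := L2M lw (test_function_L2 tN).
have [iw' e] := Rint_oppr (integrableR_measurable iw) iw.
rewrite -e; have -> : \int[mu]_x (-1 * w (- x) * phi x) = - \int[mu]_x (w (- x) * phi (- - x)).
  under eq_Rint do rewrite -mulrA.
  rewrite RintZ ?mulN1r; first by under [in RHS]eq_Rint do rewrite opprK.
  by move: iw'; congr integrableR; apply/funext => x; rewrite opprK.
by rewrite opprK.
Qed.

End Sobolev.

(** * The decreasing profile *)

Section Asymptotics.
Context {R : realType}.
Implicit Types (f g h u v w : R -> R) (a b c d e x y s t M : R).

Definition vanishes_at_infty h := forall e, 0 < e ->
  exists M, forall x, M <= x -> `|h x| <= e.

(** The lower limit of |h| at plus infinity is 0. For a monotone function this already fixes the
    sign, and unlike a limit it can be obtained for expressions containing v'. *)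
Definition frequently_small h := forall e M, 0 < e ->
  exists2 x, M < x & `|h x| <= e.

Lemma nonincreasing_frequently_small_ge0 h (dh : R -> R) M : frequently_small h ->
  (forall x, M <= x -> is_derive x 1 h (dh x)) -> (forall x, M < x -> dh x <= 0) ->
  forall x, M <= x -> 0 <= h x.
Proof.
move=> fh hd h0 x Mx; rewrite leNgt; apply/negP => hx.
have [|y xy] := fh (- h x / 2) x; first by lra.
apply/negP; rewrite -ltNge ltr_normr; apply/orP; right.
suff : h y <= h x by lra.
apply: (derive_le0_le (df := dh)); first exact: ltW.
- by move=> z /andP[xz _]; apply: hd; lra.
- by move=> z /andP[xz _]; apply: h0; lra.
Qed.

(** On [x, x + 1] the derivative takes the value h(x + 1) - h(x), which is small for large x. *)
Lemma vanishes_derive_frequently h (dh : R -> R) : (forall x, is_derive x 1 h (dh x)) ->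
  vanishes_at_infty h -> forall e M, 0 < e ->
  exists2 x, M < x & `|h x| <= e /\ `|dh x| <= e.
Proof.
move=> hd h0 e M e0; have e20 : 0 < e / 2 by lra.
have [N hN] := h0 _ e20; pose x := Num.max N M.
have xN : N <= x by rewrite le_max lexx.
have xM : M <= x by rewrite le_max lexx orbT.
have [z /andP[xz zx] ez] := mean_value (ltac:(lra) : x < x + 1) (fun t _ => hd t).
have := hN _ xN; have := hN (x + 1) ltac:(lra); have := hN z ltac:(lra).
have {}ez : dh z = h (x + 1) - h x by rewrite ez addrAC subrr add0r mulr1.
rewrite !ler_norml => /andP[z1 z2] /andP[a1 a2] /andP[b1 b2].
by exists z; [lra|rewrite !ler_norml; split; apply/andP; split; lra].
Qed.

(** The zero is the supremum of the points of [a, b] where [h] is nonnegative. *)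
Lemma last_zero h a b : continuous h -> a <= b -> 0 <= h a -> h b < 0 ->
  exists2 y, a <= y < b & h y = 0 /\ forall x, y < x <= b -> h x < 0.
Proof.
move=> ch ab ha hb; pose A := [set x | a <= x <= b /\ 0 <= h x].
have supA : has_sup A.
  split; first by exists a; split => //; rewrite lexx.
  by exists b => x [/andP[]].
have aA : A a by split => //; rewrite lexx.
have ay : a <= sup A by apply: ub_le_sup => //; case: supA.
have yb : sup A <= b by apply: ge_sup; [case: supA|move=> x [/andP[]]].
have after x : sup A < x <= b -> h x < 0.
  move=> /andP[yx xb]; rewrite ltNge; apply/negP => hx.
  have : x <= sup A by apply: ub_le_sup; [case: supA|split => //; rewrite xb andbT; lra].
  lra.
have hy0 : 0 <= h (sup A).
  rewrite leNgt; apply/negP => hy.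
  have /continuousP_dist/(_ (- h (sup A)))[|d d0 hd] := ch (sup A); first by lra.
  have [x [/andP[ax xb] hx] yx] := sup_adherent d0 supA.
  have xy : x <= sup A by apply: ub_le_sup; [case: supA|split => //; rewrite ax].
  have /hd : `|x - sup A| < d by rewrite ltr_norml; lra.
  by rewrite ltr_norml => /andP[]; lra.
have {}yb : sup A < b.
  by rewrite lt_neqAle yb andbT; apply/eqP => E; move: hb; rewrite -E; lra.
exists (sup A); first by rewrite ay.
split => //; apply/eqP; rewrite eq_le hy0 andbT leNgt; apply/negP => hy.
have /continuousP_dist/(_ _ hy)[d d0 hd] := ch (sup A).
pose x := Num.min b (sup A + d / 2).
have xb : x <= b by rewrite ge_min lexx.
have xd : x <= sup A + d / 2 by rewrite ge_min lexx orbT.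
have yx : sup A < x by rewrite lt_min yb ltrDl divr_gt0.
have := after x; rewrite yx xb => /(_ isT) hx.
have /hd : `|x - sup A| < d by rewrite ltr_norml; lra.
by rewrite ltr_norml => /andP[]; lra.
Qed.

(** This is [last_zero] for x -> - h(- x), which exchanges the two ends and the two signs. *)
Lemma first_zero h a b : continuous h -> a <= b -> 0 < h a -> h b <= 0 ->
  exists2 y, a < y <= b & h y = 0 /\ forall x, a <= x < y -> 0 < h x.
Proof.
move=> ch ab ha hb; have cN : continuous (fun x => - h (- x)).
  by move=> x; apply: continuousN; exact: continuous_oppr.
have ab' : - b <= - a by rewrite lerN2.
have hb' : 0 <= - h (- - b) by rewrite opprK oppr_ge0.
have ha' : - h (- - a) < 0 by rewrite opprK oppr_lt0.
have [y /andP[y1 y2] [hy hx]] := last_zero cN ab' hb' ha'.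
exists (- y); first by apply/andP; split; lra.
split; first by apply/eqP; rewrite -oppr_eq0 hy.
move=> x /andP[ax xy]; have := hx (- x); rewrite opprK oppr_lt0; apply.
by apply/andP; split; lra.
Qed.

End Asymptotics.

(** * Monotonicity and decay of a positive solution with vanishing slope at 0 *)

Section Profile.
Context {R : realType}.
Implicit Types (a b c d e x y s t M : R).
Context (f : R -> R -> R) (l : R) (u u1 : R -> R).
Let g := ftilde f.
Let u2 x := l * u x - g x (u x).
Context (hg : C1_plane g) (l0 : 0 < l).
Context (f_decr : forall x y s, 0 <= x < y -> 0 < s -> f y s < f x s).
Context (f_vanish : forall e, 0 < e -> exists M, forall x s, M <= x -> 0 <= s -> `|f x s| <= e).
Context (f_lt_pd2 : forall x s, 0 < x -> 0 < s -> f x (s ^+ 2) < pd2 g x s).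
Context (u0 : forall x, 0 < u x) (du : forall x, is_derive x 1 u (u1 x)).
Context (du1 : forall x, is_derive x 1 u1 (u2 x)).
Context (u_vanish : vanishes_at_infty u) (u10 : u1 0 = 0).

Let u2E x : u2 x = (l - f x (u x ^+ 2)) * u x.
Proof. by rewrite /u2 /g /ftilde mulrBl. Qed.

Let cu : continuous u. Proof. exact: derivable_eq_continuous du. Qed.
Let cu1 : continuous u1. Proof. exact: derivable_eq_continuous du1. Qed.

(** There are arbitrarily distant points where u and u' are small together, so energies that vanish
    at u = u' = 0 are small there. *)
Lemma frequently_small_profile (F : R -> R) c k : {for 0, continuous F} -> F 0 = 0 ->
  frequently_small (fun x => c * u1 x ^+ 2 + F (u x) + k * u x ^+ 2).
Proof.
move=> /continuousP_dist cF F0 e M e0.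
have [d d0 hd] := cF (e / 2) ltac:(lra).
(* The three bounds serve the continuity of F at 0, the estimate of squares by first powers, and the
   quadratic terms, which receive half of e. *)
pose m := Num.min (Num.min (d / 2) 1) (e / (2 * (`|c| + `|k| + 1))).
have ck : 0 < `|c| + `|k| + 1 by rewrite ltr_wpDl// addr_ge0.
have m0 : 0 < m by rewrite !lt_min ltr01 !divr_gt0// mulr_gt0.
have [x Mx [ux u1x]] := vanishes_derive_frequently du u_vanish M m0.
exists x => //; have md : m <= d / 2 by rewrite /m !ge_min lexx.
have m1 : m <= 1 by rewrite /m !ge_min lexx orbT.
have me : m * (2 * (`|c| + `|k| + 1)) <= e.
  by rewrite -ler_pdivlMr ?mulr_gt0// /m !ge_min lexx orbT.
have Fx : `|F (u x)| <= e / 2.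
  by rewrite -[F (u x)]subr0 -F0; apply/ltW/hd; rewrite subr0; lra.
have sq t : `|t| <= m -> `|t ^+ 2| <= m.
  move=> tm; rewrite normrX; apply: le_trans (tm).
  by have : 0 <= `|t| by []; nra.
apply: le_trans (ler_normD _ _) _; apply: le_trans (lerD (ler_normD _ _) (lexx _)) _.
rewrite (normrM c) (normrM k).
have h1 : `|c| * `|u1 x ^+ 2| <= `|c| * m by rewrite ler_wpM2l// sq.
have h2 : `|k| * `|u x ^+ 2| <= `|k| * m by rewrite ler_wpM2l// sq.
lra.
Qed.

Let tail_convex : exists2 M, 0 < M & forall x, M <= x ->
  l / 2 * u x <= u2 x /\ u2 x <= 3 * l / 2 * u x.
Proof.
have lp := l0.
have [M hM] := f_vanish (ltac:(lra) : 0 < l / 2).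
exists (Num.max M 1); first by rewrite lt_max ltr01 orbT.
move=> x; rewrite ge_max => /andP[Mx _].
have := hM x (u x ^+ 2) Mx (sqr_ge0 _); rewrite ler_norml u2E => /andP[f1 f2].
by split; rewrite ler_pM2r//; lra.
Qed.

Let tail_neg : exists M, forall x, M <= x -> u1 x < 0.
Proof.
have lp := l0; have [M M0 hM] := tail_convex.
have u2p x : M <= x -> 0 < u2 x.
  by move=> /hM[h _]; apply: lt_le_trans h; rewrite mulr_gt0//; lra.
have u1N x : M <= x -> u1 x <= 0.
  move=> Mx; rewrite -oppr_ge0.
  apply: (@nonincreasing_frequently_small_ge0 _ (fun x => - u1 x) (fun x => - u2 x) M) => //.
    move=> e N e0; have [y Ny [_ h]] := vanishes_derive_frequently du u_vanish N e0.
    by exists y => //; rewrite normrN.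
  by move=> y /ltW/u2p; lra.
exists M => x Mx; apply: (lt_le_trans _ (u1N (x + 1) _)); last by lra.
apply: (derive_gt0_lt (df := u2)) => //; first by lra.
by move=> y /andP[xy _]; apply: u2p; lra.
Qed.

(* The energy u'^2/2 + F_y(u) - l u^2/2 with the first argument of f frozen at a
   critical point y: its derivative u' u (f(y,u^2) - f(x,u^2)) has a known sign. *)
Let energy_critical y : 0 < y -> exists E : R -> R,
  [/\ frequently_small E,
      forall x, is_derive x 1 E (u1 x * u x * (f y (u x ^+ 2) - f x (u x ^+ 2))) &
      forall x, u1 x = 0 -> 0 < E x -> l < f y (u x ^+ 2)].
Proof.
move=> y0; have dgy s : is_derive s 1 (g y) (pd2 g y s) by exact: is_derive_pd2.
have [F dF F0] := continuous_primitive (derivable_eq_continuous dgy).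
(* The difference of the two sides has derivative s (g_s(y,s) - f(y,s^2)) / 2, which is nonnegative.
   At a critical point of u, positive energy then says f(y,u^2) u^2 > l u^2. *)
have Fle s : 0 <= s -> F s <= 2^-1 * (s * g y s).
  move=> s0; rewrite -subr_ge0.
  rewrite [leLHS](_ : 0 = 2^-1 * (0 * g y 0) - F 0); last by rewrite F0; ring.
  apply: (@derive_ge0_le _ (fun s => 2^-1 * (s * g y s) - F s)
    (fun s => 2^-1 * (s * (pd2 g y s - f y (s ^+ 2))))) => //.
  - move=> t _; have := is_deriveB1 (is_deriveM1 (is_derive1_cst 2^-1 t)
      (is_deriveM1 (is_derive1_id t) (dgy t))) (dF t).
    by move/is_derive_eq; apply; rewrite /g /ftilde; field.
  - move=> t /andP[t0 _]; apply: mulr_ge0; first by rewrite invr_ge0.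
    by rewrite mulr_ge0 ?(ltW t0)// subr_ge0 ltW// f_lt_pd2.
exists (fun x => 2^-1 * u1 x ^+ 2 + F (u x) + (- (l / 2)) * u x ^+ 2); split.
- by apply: frequently_small_profile => //; exact: is_derive_continuous (dF 0).
- move=> x.
  have h1 := is_deriveM1 (is_derive1_cst 2^-1 x) (is_deriveX1 1 (du1 x)).
  have h2 := is_derive_comp1 (dF (u x)) (du x).
  have h3 := is_deriveM1 (is_derive1_cst (- (l / 2)) x) (is_deriveX1 1 (du x)).
  apply: is_derive_eq (is_deriveD1 (is_deriveD1 h1 h2) h3) _.
  by rewrite u2E /g /ftilde; field.
- move=> x u1x; rewrite u1x expr0n mulr0 add0r mulNr subr_gt0 => E0.
  have := Fle _ (ltW (u0 x)); rewrite /g /ftilde => h.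
  have : 0 < (f y (u x ^+ 2) - l) * u x ^+ 2 by lra.
  by rewrite pmulr_lgt0 ?exprn_gt0// subr_gt0.
Qed.

(** Otherwise u' has a last zero y > 0. Freezing at y, the energy decreases beyond y and is
    frequently small, so it is positive at y; hence u''(y) < 0 and u' > 0 just before y. Let y' be
    the preceding zero of u'. Between y' and y the energy decreases again, so it is positive at y',
    and f(y',.) > f(y,.) gives u''(y') < 0: u' would be negative just after y', where it is
    positive. *)
Lemma profile_decreasing x : 0 < x -> u1 x < 0.
Proof.
move=> x0; rewrite ltNge; apply/negP => u1x.
have [M hM] := tail_neg.
pose N := Num.max M (x + 1).
have MN : M <= N by rewrite le_max lexx.
have xN : x < N by rewrite lt_max ltrDl ltr01 orbT.
have [y /andP[xy yN] [u1y after]] := last_zero cu1 (ltW xN) u1x (hM _ MN).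
have y0 : 0 < y by lra.
have {}after z : y < z -> u1 z < 0.
  move=> yz; case: (leP z N) => zN; first by apply: after; rewrite yz.
  by apply: hM; lra.
have [E [fE dE EC]] := energy_critical y0.
have fd a b z : 0 <= a < b -> f b (u z ^+ 2) < f a (u z ^+ 2).
  by move=> ab; apply: f_decr => //; rewrite exprn_gt0.
have Ey : 0 < E y.
  apply: (@le_lt_trans _ _ (E (y + 1))).
    apply: (nonincreasing_frequently_small_ge0 fE (fun z _ => dE z) (M := y)); last by lra.
    move=> z yz; rewrite mulr_le0_ge0//; first by rewrite mulr_le0_ge0// ltW// after.
    by rewrite subr_ge0 ltW// fd//; lra.
  apply: (derive_lt0_lt _ (fun z _ => dE z)); first by lra.
  move=> z /andP[yz _]; rewrite nmulr_rlt0 ?subr_gt0; first by apply: fd; lra.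
  by rewrite nmulr_rlt0// after.
have fy := EC _ u1y Ey.
have u2y : u2 y < 0 by rewrite u2E nmulr_rlt0// subr_lt0.
have [d d0 hd] := is_derive_sign (du1 y) u2y.
(* The point must lie in the neighbourhood of y where the sign of u' is known and must stay to the
   right of 0. *)
pose z := Num.max (y / 2) (y - d / 2).
have z1 : y / 2 <= z by rewrite le_max lexx.
have z2 : y - d / 2 <= z by rewrite le_max lexx orbT.
have z3 : z < y by rewrite gt_max; apply/andP; split; lra.
have near w : z <= w < y -> 0 < u1 w.
  move=> /andP[zw wy]; rewrite -u1y.
  have [|_] := hd w; first by rewrite ltr0_norm; lra.
  by apply.
have cN : continuous (fun x => - u1 x) by move=> t; apply: continuousN; exact: cu1.
have z0 : 0 <= z by lra.
have nu0 : 0 <= - u1 0 by rewrite u10 oppr0.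
have nuz : - u1 z < 0 by rewrite oppr_lt0 near// lexx.
(* The vanishing of u' at 0 guarantees a preceding zero; y' may be 0 itself. *)
have [y' /andP[y'0 y'z] [u1y' btw]] := last_zero cN z0 nu0 nuz.
move/eqP: u1y'; rewrite oppr_eq0 => /eqP u1y'.
have pos w : y' < w < y -> 0 < u1 w.
  move=> /andP[yw wy]; case: (ltP w z) => wz; last by apply: near; rewrite wz.
  by rewrite -oppr_lt0; apply: btw; rewrite yw ltW.
have Ey' : 0 < E y'.
  apply: lt_le_trans Ey _; apply: (derive_le0_le _ (fun z _ => dE z)); first by lra.
  move=> w /andP[yw wy]; rewrite mulr_ge0_le0//.
    by rewrite mulr_ge0// ltW// pos// yw.
  by rewrite subr_le0 ltW// fd//; lra.
have fy' := EC _ u1y' Ey'.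
have u2y' : u2 y' < 0.
  by rewrite u2E nmulr_rlt0// subr_lt0 (lt_trans fy')// fd//; lra.
have [d' d'0 hd'] := is_derive_sign (du1 y') u2y'.
pose w := Num.min z (y' + d' / 2).
have w1 : w <= z by rewrite ge_min lexx.
have w2 : w <= y' + d' / 2 by rewrite ge_min lexx orbT.
have w3 : y' < w by rewrite lt_min; apply/andP; split; lra.
have [|h _] := hd' w; first by rewrite gtr0_norm; lra.
by have := h w3; rewrite u1y'; have := pos w ltac:(lra); lra.
Qed.

(** On the tail u'' lies between l/2 u and 3l/2 u, so u'^2 - l/2 u^2 and 3l/2 u^2 - u'^2 are
    nonincreasing and frequently small, hence nonnegative. The lower bound on -u' makes x^2 u
    nonincreasing; the upper bounds transfer its boundedness to u' and u''. *)
Lemma profile_decay : exists K M, 0 < M /\ forall x, M <= x ->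
  [/\ x ^+ 2 * u x <= K, x ^+ 2 * `|u1 x| <= K & x ^+ 2 * `|u2 x| <= K].
Proof.
have lp := l0; have [M M0 hM] := tail_convex.
have fs c k : frequently_small (fun x => c * u1 x ^+ 2 + k * u x ^+ 2).
  have := @frequently_small_profile (fun=> 0) c k (@cst_continuous _ _ _ _) erefl.
  by congr frequently_small; apply/funext => x; rewrite addr0.
have dd c k x : is_derive x 1 (fun x => c * u1 x ^+ 2 + k * u x ^+ 2)
    (2 * u1 x * (c * u2 x + k * u x)).
  have h1 := is_deriveM1 (is_derive1_cst c x) (is_deriveX1 1 (du1 x)).
  have h3 := is_deriveM1 (is_derive1_cst k x) (is_deriveX1 1 (du x)).
  by apply: is_derive_eq (is_deriveD1 h1 h3) _; ring.
have lo x : M <= x -> l / 2 * u x ^+ 2 <= u1 x ^+ 2.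
  move=> Mx; suff : 0 <= 1 * u1 x ^+ 2 + - (l / 2) * u x ^+ 2 by lra.
  apply: (nonincreasing_frequently_small_ge0 (fs _ _) (fun z _ => dd _ _ z) (M := M)) => //.
  move=> z Mz; have [h1 _] := hM z (ltW Mz); have := profile_decreasing (lt_trans M0 Mz).
  by nra.
have up x : M <= x -> u1 x ^+ 2 <= 3 * l / 2 * u x ^+ 2.
  move=> Mx; suff : 0 <= (-1) * u1 x ^+ 2 + (3 * l / 2) * u x ^+ 2 by lra.
  apply: (nonincreasing_frequently_small_ge0 (fs _ _) (fun z _ => dd _ _ z) (M := M)) => //.
  move=> z Mz; have [_ h1] := hM z (ltW Mz); have := profile_decreasing (lt_trans M0 Mz).
  by nra.
pose c := Num.sqrt (l / 2).
have c0 : 0 < c by rewrite sqrtr_gt0; lra.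
have c2 : c ^+ 2 = l / 2 by rewrite sqr_sqrtr//; lra.
have lo1 x : M <= x -> c * u x <= - u1 x.
  move=> Mx; have := lo _ Mx; rewrite -c2 -exprMn -[leRHS]sqrrN.
  rewrite ler_pXn2r// nnegrE; first by rewrite mulr_ge0// ltW.
  by rewrite oppr_ge0 ltW// profile_decreasing//; lra.
(* The constant 3l/2 + 1 exceeds the square root of 3l/2 and also bounds |u''| / u, so one constant
   serves both. *)
have up1 x : M <= x -> `|u1 x| <= (3 * l / 2 + 1) * u x.
  move=> Mx; have := up _ Mx; have := u0 x => ux h.
  rewrite -(@ler_pXn2r _ 2)// ?nnegrE ?mulr_ge0//; [|lra|exact: ltW].
  rewrite real_normK ?num_real// exprMn; apply: le_trans h _.
  by rewrite ler_wpM2r ?sqr_ge0//; nra.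
have up2 x : M <= x -> `|u2 x| <= (3 * l / 2 + 1) * u x.
  move=> Mx; have [h1 h2] := hM x Mx; have ux := u0 x.
  by rewrite ler_norml; apply/andP; split; nra.
(* Beyond 2 / c the decay rate c outweighs the factor 2 / x produced by differentiating x^2. *)
pose N := Num.max M (2 / c).
have N0 : 0 < N by rewrite lt_max M0.
have MN : M <= N by rewrite le_max lexx.
have cN : 2 <= c * N by rewrite mulrC -ler_pdivrMr// le_max lexx orbT.
have dec x : N <= x -> x ^+ 2 * u x <= N ^+ 2 * u N.
  move=> Nx; apply: (derive_le0_le Nx
    (fun t _ => is_deriveM1 (is_deriveX1 1 (is_derive1_id t)) (du t))) => t /andP[Nt _].
  have := lo1 t ltac:(lra); have := u0 t => ut h.
  rewrite mulr1 expr1; have : 2 <= c * t by nra.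
  move=> ct; have : t * (2 * u t + t * u1 t) <= 0; last by lra.
  rewrite mulr_ge0_le0//; [lra|nra].
exists ((3 * l / 2 + 1) * (N ^+ 2 * u N)), N; split => // x Nx.
have k1 : 1 <= 3 * l / 2 + 1 by lra.
have dx := dec x Nx; have x2 : 0 <= x ^+ 2 by exact: sqr_ge0.
have ux := u0 x; have NN : 0 <= N ^+ 2 * u N by rewrite mulr_ge0 ?sqr_ge0// ltW.
split.
- by apply: le_trans dx _; rewrite ler_peMl.
- apply: (@le_trans _ _ (x ^+ 2 * ((3 * l / 2 + 1) * u x))).
    by rewrite ler_wpM2l// up1//; lra.
  by rewrite mulrCA ler_wpM2l//; lra.
- apply: (@le_trans _ _ (x ^+ 2 * ((3 * l / 2 + 1) * u x))).
    by rewrite ler_wpM2l// up2//; lra.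
  by rewrite mulrCA ler_wpM2l//; lra.
Qed.

End Profile.

(** * The linearised equation *)

Section Linearization.
Context {R : realType}.
Implicit Types (a b c d e x y s t M : R).
Context (f : R -> R -> R) (l : R) (u u1 v v1 : R -> R).
Let g := ftilde f.
Let u2 x := l * u x - g x (u x).
Let q x := pd2 g x (u x).
Let r x := pd1 g x (u x).
Let v2 x := l * v x - q x * v x + u x.
Context (hg : C1_plane g) (l0 : 0 < l).
Context (f_decr : forall x y s, 0 <= x < y -> 0 < s -> f y s < f x s).
Context (f_vanish : forall e, 0 < e -> exists M, forall x s, M <= x -> 0 <= s -> `|f x s| <= e).
Context (f_lt_pd2 : forall x s, 0 < x -> 0 < s -> f x (s ^+ 2) < pd2 g x s).
Context (pd1_lt0 : forall x s, 0 < x -> 0 < s -> pd1 g x s < 0).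
Context (hfunE : forall x s, 0 < x -> 0 < s ->
  (hfun f x (s ^+ 2) + 1) * ((pd2 g x s - f x (s ^+ 2)) * s / 2)
  = 2 * g x s + x * pd1 g x s).
Context (hH : AH f).
Context (u0 : forall x, 0 < u x) (du : forall x, is_derive x 1 u (u1 x)).
Context (du1 : forall x, is_derive x 1 u1 (u2 x)).
Context (u_vanish : vanishes_at_infty u) (u10 : u1 0 = 0).
Context (dv : forall x, is_derive x 1 v (v1 x)) (dv1 : forall x, is_derive x 1 v1 (v2 x)).
Context (v_vanish : vanishes_at_infty v) (v10 : v1 0 = 0).

Let u1_lt0 x : 0 < x -> u1 x < 0.
Proof. exact: (profile_decreasing hg l0 f_decr f_vanish f_lt_pd2 u0 du du1 u_vanish u10). Qed.

Let cv : continuous v. Proof. exact: derivable_eq_continuous dv. Qed.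

Let du2 x : is_derive x 1 u2 (l * u1 x - (r x + q x * u1 x)).
Proof.
apply: is_derive_eq (is_deriveB1 (is_deriveM1 (is_derive1_cst l x) (du x))
  (is_derive_chain2 hg (du x))) _.
by rewrite mul0r add0r.
Qed.

Let qf x : 0 < x -> 0 < (q x - f x (u x ^+ 2)) * u x.
Proof. by move=> x0; rewrite mulr_gt0// subr_gt0 f_lt_pd2. Qed.

(** Points where v and v' are at most 1 are taken beyond K / e, where a bound x^2 t <= K becomes x t
    <= e. *)
Let boundary e M : 0 < e -> exists2 x, M < x &
  [/\ 1 <= x, `|v x| <= 1, `|v1 x| <= 1, x * u x <= e & x * `|u1 x| <= e /\ x * `|u2 x| <= e].
Proof.
move=> e0.
have [K [N [N0 hN]]] := profile_decay hg l0 f_decr f_vanish f_lt_pd2 u0 du du1 u_vanish u10.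
have [x Mx [vx v1x]] := vanishes_derive_frequently dv v_vanish
  (Num.max M (Num.max N (Num.max 1 (K / e)))) ltr01.
move: Mx; rewrite !gt_max => /and4P[Mx Nx x1 Kx]; exists x => //.
have [h1 h2 h3] := hN x (ltW Nx).
have Kex : K <= e * x by move: Kx; rewrite ltr_pdivrMr// => /ltW; rewrite mulrC.
have x0 : 0 < x by lra.
have red t : x ^+ 2 * t <= K -> x * t <= e.
  by move=> h; rewrite -(ler_pM2l x0) mulrA -expr2 (le_trans h)// mulrC.
by split; rewrite ?(ltW x1)//; [exact: red|split; exact: red].
Qed.

Let bounded_mul a b e : `|a| <= 1 -> `|b| <= e -> - e <= a * b <= e.
Proof.
by move=> a1 be; rewrite -ler_norml normrM (le_trans _ be)// ler_piMl.
Qed.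

(** The Wronskian of u and v; its derivative is 2 w v - u^2 with w as in the overview. *)
Let Wr x := u1 x * v x - u x * v1 x.

Let dWr x : is_derive x 1 Wr ((q x - f x (u x ^+ 2)) * u x * v x - u x ^+ 2).
Proof.
apply: is_derive_eq (is_deriveB1 (is_deriveM1 (du1 x) (dv x)) (is_deriveM1 (du x) (dv1 x))) _.
by rewrite /u2 /v2 /g /ftilde; ring.
Qed.

(** Differentiating the equation in x gives L u' = - r; together with L v = u this yields the
    derivative of the Wronskian [Z]. *)
Let Z x := v x * u2 x - u1 x * v1 x.

Let dZ x : is_derive x 1 Z (- (u1 x * u x) - v x * r x).
Proof.
apply: is_derive_eq (is_deriveB1 (is_deriveM1 (dv x) (du2 x)) (is_deriveM1 (du1 x) (dv1 x))) _.
by rewrite /u2 /v2; ring.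
Qed.

Let Z_small : frequently_small Z.
Proof.
move=> e M e0; have [x Mx [x1 vx v1x ux [u1x u2x]]] := boundary M (ltac:(lra) : 0 < e / 2).
exists x => //; have h1 : `|u1 x| <= e / 2 by rewrite (le_trans _ u1x)// ler_peMl.
have h2 : `|u2 x| <= e / 2 by rewrite (le_trans _ u2x)// ler_peMl.
have := bounded_mul vx h2; have := bounded_mul v1x h1.
by rewrite ler_norml /Z; lra.
Qed.

Let Wr_small : frequently_small Wr.
Proof.
move=> e M e0; have [x Mx [x1 vx v1x ux [u1x u2x]]] := boundary M (ltac:(lra) : 0 < e / 2).
exists x => //; have h1 : `|u1 x| <= e / 2 by rewrite (le_trans _ u1x)// ler_peMl.
have h2 : `|u x| <= e / 2.
  by rewrite gtr0_norm// (le_trans _ ux)// ler_peMl// ltW.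
have := bounded_mul vx h1; have := bounded_mul v1x h2.
by rewrite ler_norml /Wr; lra.
Qed.

(* A positivity interval of v starting from a zero is excluded by the Wronskian of
   -u' and v, which increases there: -u' is a strict supersolution. *)
Let no_return a b : 0 <= a -> a < b -> v a <= 0 -> v b <= 0.
Proof.
move=> a0 ab va; rewrite leNgt; apply/negP => vb.
have cN : continuous (fun x => - v x) by move=> t; apply: continuousN; exact: cv.
have va' : 0 <= - v a by rewrite oppr_ge0.
have vb' : - v b < 0 by rewrite oppr_lt0.
have [y /andP[ay yb] [vy after]] := last_zero cN (ltW ab) va' vb'.
have {}vy : v y = 0 by apply/eqP; rewrite -oppr_eq0 vy.
have y0 : 0 <= y by lra.
have u1y : u1 y <= 0.
  by case: (ltgtP y 0) y0 => // [/u1_lt0/ltW//|-> _]; rewrite u10.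
have v1y : 0 <= v1 y.
  rewrite leNgt; apply/negP => v1y.
  have [d d0 hd] := is_derive_sign (dv y) v1y.
  pose w := Num.min b (y + d / 2).
  have w1 : w <= b by rewrite ge_min lexx.
  have w2 : w <= y + d / 2 by rewrite ge_min lexx orbT.
  have w3 : y < w by rewrite lt_min yb ltrDl divr_gt0.
  have [|h _] := hd w; first by rewrite gtr0_norm; lra.
  have := after w; rewrite w3 w1 oppr_lt0 => /(_ isT).
  by have := h w3; rewrite vy; lra.
have Zy : 0 <= Z y by rewrite /Z vy mul0r sub0r oppr_ge0 mulr_le0_ge0.
have dZ0 z : y < z -> 0 < v z -> 0 < - (u1 z * u z) - v z * r z.
  move=> yz vz; have z0 : 0 < z by lra.
  have h1 : u1 z * u z < 0 by rewrite nmulr_rlt0// u1_lt0.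
  have h2 : v z * r z < 0 by rewrite pmulr_rlt0// pd1_lt0.
  by lra.
(* At a next zero k of v, v'(k) <= 0 and u'(k) < 0 make [Z] nonpositive, although it has strictly
   increased from a nonnegative value at y. *)
have vpos z : y < z -> 0 < v z.
  move=> yz; rewrite ltNge; apply/negP => vz.
  have bz : b <= z.
    rewrite leNgt; apply/negP => zb; have := after z; rewrite yz ltW// oppr_lt0.
    by move=> /(_ isT); lra.
  have [k /andP[bk kz] [vk before]] := first_zero cv bz vb vz.
  have v1k : v1 k <= 0.
    rewrite leNgt; apply/negP => v1k.
    have nv1k : - v1 k < 0 by rewrite oppr_lt0.
    have [d d0 hd] := is_derive_sign (is_deriveN1 (dv k)) nv1k.
    pose w := Num.max b (k - d / 2).
    have w1 : b <= w by rewrite le_max lexx.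
    have w2 : k - d / 2 <= w by rewrite le_max lexx orbT.
    have w3 : w < k by rewrite gt_max bk ltrBlDr ltrDl divr_gt0.
    have [|_ h] := hd w; first by rewrite ltr0_norm; lra.
    have := before w; rewrite w1 w3 => /(_ isT).
    by have := h w3; rewrite vk; lra.
  have : Z y < Z k.
    apply: (derive_gt0_lt _ (fun t _ => dZ t)); first by lra.
    move=> t /andP[yt tk]; apply: dZ0 => //.
    case: (leP t b) => tb; first by rewrite -oppr_lt0; apply: after; rewrite yt.
    by apply: before; rewrite tk ltW.
  rewrite ltNge => /negP; apply; apply: le_trans Zy.
  by rewrite /Z vk mul0r sub0r oppr_le0 mulr_le0// ltW// u1_lt0//; lra.
have : Z y < Z b.
  apply: (derive_gt0_lt yb (fun t _ => dZ t)) => t /andP[yt _].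
  by apply: dZ0 => //; exact: vpos.
(* With v positive all the way to infinity, [Z] keeps increasing and is frequently small, so it
   cannot be positive at b. *)
have NZ_small : frequently_small (fun t => - Z t).
  by move=> e M e0; have [x Mx h] := Z_small M e0; exists x; rewrite ?normrN.
have : 0 <= - Z b.
  apply: (nonincreasing_frequently_small_ge0 NZ_small (fun t _ => is_deriveN1 (dZ t)) _ (lexx b)).
  move=> x bx; rewrite oppr_le0; apply/ltW/dZ0; first by lra.
  by apply: vpos; lra.
by lra.
Qed.

(** If v(0) <= 0, then v <= 0 on the whole half-line by [no_return], so [Wr] strictly decreases from
    0; being frequently small, it could not be negative at 1. *)
Let v0_gt0 : 0 < v 0.
Proof.
rewrite ltNge; apply/negP => v0.
have dW0 x : 0 < x -> (q x - f x (u x ^+ 2)) * u x * v x - u x ^+ 2 < 0.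
  move=> x0; have := no_return (lexx 0) x0 v0 => vx.
  have : (q x - f x (u x ^+ 2)) * u x * v x <= 0 by rewrite pmulr_rle0// qf.
  by have := exprn_gt0 2 (u0 x); lra.
have : 0 <= Wr 1.
  apply: (nonincreasing_frequently_small_ge0 Wr_small (fun t _ => dWr t) (M := 1)) => // x x1.
  by apply/ltW/dW0; lra.
have : Wr 1 < Wr 0.
  by apply: (derive_lt0_lt ltr01 (fun t _ => dWr t)) => x /andP[/dW0].
by rewrite /Wr u10 v10 mul0r mulr0 subrr; lra.
Qed.

(** The Wronskian of x u' and v, corrected so that its derivative on x > 0 is 2 l u v - h w v. The
    term x u^2 / 2 cancels - x u u', coming from L v = u, at the cost of u^2 / 2, and [Wr] / 2
    removes that while turning h + 1 into h. *)
Let B x := (u1 x + x * u2 x) * v x - x * u1 x * v1 x + 2^-1 * Wr x + 2^-1 * (x * u x ^+ 2).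

Let dB x : is_derive x 1 B (2 * l * (u x * v x) - (2 * g x (u x) + x * r x) * v x
  + (q x - f x (u x ^+ 2)) * u x / 2 * v x).
Proof.
have h1 := is_deriveM1 (is_deriveD1 (du1 x) (is_deriveM1 (is_derive1_id x) (du2 x))) (dv x).
have h2 := is_deriveM1 (is_deriveM1 (is_derive1_id x) (du1 x)) (dv1 x).
have h3 := is_deriveM1 (is_derive1_cst 2^-1 x) (dWr x).
have h4 := is_deriveM1 (is_derive1_cst 2^-1 x)
  (is_deriveM1 (is_derive1_id x) (is_deriveX1 1 (du x))).
apply: is_derive_eq (is_deriveD1 (is_deriveD1 (is_deriveB1 h1 h2) h3) h4) _.
by rewrite /u2 /v2 /g /ftilde; field.
Qed.

Let B_small k : frequently_small (fun x => B x + k * Wr x).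
Proof.
(* At the chosen points |B| <= 6 m and |Wr| <= 2 m, whence the factor 8; the bound m <= 1 handles
   the square in x u^2. *)
move=> e M e0; pose m := Num.min 1 (e / (8 * (1 + `|k|))).
have k0 : 0 < 8 * (1 + `|k|) by rewrite mulr_gt0// ltr_pwDl.
have m0 : 0 < m by rewrite lt_min ltr01 divr_gt0.
have m1 : m <= 1 by rewrite ge_min lexx.
have me : m * (8 * (1 + `|k|)) <= e by rewrite -ler_pdivlMr// ge_min lexx orbT.
have [x Mx [x1 vx v1x ux [u1x u2x]]] := boundary M m0.
exists x => //; have h1 : `|u1 x| <= m by rewrite (le_trans _ u1x)// ler_peMl.
have h0 : `|u x| <= m by rewrite gtr0_norm// (le_trans _ ux)// ler_peMl// ltW.
have x0 : 0 <= x by lra.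
have xu1 : `|x * u1 x| <= m by rewrite normrM ger0_norm.
have xu2 : `|x * u2 x| <= m by rewrite normrM ger0_norm.
have a1 := bounded_mul vx h1; have a2 := bounded_mul v1x h0.
have a3 := bounded_mul vx xu2; have a4 := bounded_mul v1x xu1.
have xuu : 0 <= x * u x ^+ 2 <= m.
  rewrite mulr_ge0 ?sqr_ge0//= expr2 mulrA; apply: le_trans ux.
  rewrite ler_piMr ?mulr_ge0 ?(ltW (u0 x))//; apply: le_trans m1.
  by apply: le_trans h0; exact: ler_norm.
have WW : `|Wr x| <= 2 * m by rewrite ler_norml /Wr; lra.
have BB : `|B x| <= 6 * m.
  by move: WW; rewrite !ler_norml /B => /andP[? ?]; lra.
apply: le_trans (ler_normD _ _) _; rewrite (normrM k).
have : `|k| * `|Wr x| <= `|k| * (2 * m) by rewrite ler_wpM2l.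
have : 0 <= `|k| * m by rewrite mulr_ge0// ltW.
by lra.
Qed.

(** A lower bound on partial integrals of u v over [0, x], along a sequence of x, replaces a
    statement on the improper integral. *)
Lemma linearization_positive (P : R -> R) : (forall x, is_derive x 1 P (u x * v x)) ->
  P 0 = 0 -> exists2 k, 0 < k & forall M, exists2 x, M < x & k <= P x.
Proof.
move=> dP P0; have lp := l0; have [vpos|] := pselect (forall x, 0 <= x -> 0 < v x).
  exists (P 1).
    rewrite -P0; apply: (derive_gt0_lt ltr01 (fun t _ => dP t)) => x /andP[x0 _].
    by rewrite mulr_gt0// vpos// ltW.
  move=> M; exists (Num.max 1 (M + 1)); first by rewrite lt_max ltrDl ltr01 orbT.
  apply: (derive_ge0_le _ (fun t _ => dP t)); first by rewrite le_max lexx.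
  by move=> x /andP[x1 _]; rewrite mulr_ge0// ltW// vpos; lra.
move=> /existsNP[b /not_implyP[b0 /negP]]; rewrite -leNgt => vb.
have [c /andP[c0 cb] [vc before]] := first_zero cv b0 v0_gt0 vb.
have after x : c < x -> v x <= 0.
  by move=> cx; apply: (no_return _ cx); [exact: ltW|rewrite vc].
pose k := hfun f c (u c ^+ 2).
have u2_gt0 x : 0 < u x ^+ 2 by rewrite exprn_gt0.
have k0 : 0 < k by apply: hH.1.
have udecr x y : 0 < x -> x <= y -> u y <= u x.
  move=> x0 xy; apply: (derive_le0_le xy (fun t _ => du t)) => t /andP[xt _].
  by apply/ltW/u1_lt0; lra.
have hdecr x y : 0 < x -> x <= y -> hfun f y (u y ^+ 2) <= hfun f x (u x ^+ 2).
  move=> x0 xy; apply: hH.2; rewrite ?x0//= u2_gt0/=.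
  by rewrite ler_pXn2r ?nnegrE ?(ltW (u0 _))// udecr.
have cu2 : continuous (fun x => u x ^+ 2).
  by apply: continuousMfun; exact: derivable_eq_continuous du.
have [Q dQ Q0] := continuous_primitive cu2.
(* Since [Q + Wr] has derivative 2 w v, [D] is the primitive from 0 of (h - k) w v, where k is the
   value of h at the sign change c and [A] is w. Both factors h - k and v change sign at c, so [D]
   is nondecreasing on the half-line. *)
pose D x := 2 * l * P x - B x - k / 2 * (Q x + Wr x).
pose A x := (q x - f x (u x ^+ 2)) * u x / 2.
have dD x : is_derive x 1 D ((2 * g x (u x) + x * r x) * v x - (1 + k) * (A x * v x)).
  have h1 := is_deriveM1 (is_derive1_cst (2 * l) x) (dP x).
  have h2 := is_deriveM1 (is_derive1_cst (k / 2) x) (is_deriveD1 (dQ x) (dWr x)).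
  apply: is_derive_eq (is_deriveB1 (is_deriveB1 h1 (dB x)) h2) _.
  by rewrite /A; field.
have dDE x : 0 < x -> (2 * g x (u x) + x * r x) * v x - (1 + k) * (A x * v x) =
    (hfun f x (u x ^+ 2) - k) * v x * A x.
  by move=> x0; rewrite -(hfunE x0 (u0 x)) -/(q x) -/(A x); ring.
have A0 x : 0 < x -> 0 < A x by move=> x0; rewrite /A divr_gt0 ?qf.
have D0 : D 0 = 0 by rewrite /D /B /Wr P0 Q0 u10 v10; ring.
have Dc x : 0 <= x -> x <= c -> 0 <= D x.
  move=> x0 xc; rewrite -D0; apply: (derive_ge0_le x0 (fun t _ => dD t)) => t /andP[t0 tx].
  rewrite dDE// mulr_ge0 ?(ltW (A0 _ _))// mulr_ge0//.
    by rewrite subr_ge0 hdecr//; lra.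
  by apply/ltW/before; apply/andP; split; lra.
have D_ge0 x : 0 <= x -> 0 <= D x.
  move=> x0; case: (leP x c) => [|/ltW cx]; first exact: Dc.
  apply: (le_trans (Dc _ (ltW c0) (lexx c))).
  apply: (derive_ge0_le cx (fun t _ => dD t)) => t /andP[ct tx].
  have t0 : 0 < t by lra.
  rewrite dDE// mulr_ge0 ?(ltW (A0 _ _))// mulr_le0//; last exact: after.
  by rewrite subr_le0 hdecr// ltW.
have Qmono x y : x <= y -> Q x <= Q y.
  by move=> xy; apply: (derive_ge0_le xy (fun t _ => dQ t)) => t _; exact: ltW.
have Q1 : 0 < Q 1.
  by rewrite -Q0; apply: (derive_gt0_lt ltr01 (fun t _ => dQ t)).
have kQ : 0 < k * Q 1 by rewrite mulr_gt0.
(* [D] >= 0 reads 2 l P >= k Q / 2 + (B + k/2 Wr). The bracket is at least - k Q(1) / 4 at suitable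
   points, which leaves k Q(1) / 4. *)
exists (k * Q 1 / (8 * l)); first by rewrite divr_gt0// mulr_gt0.
move=> M; have [x Mx] := B_small (k / 2) (Num.max M 1) (ltac:(lra) : 0 < k * Q 1 / 4).
move: Mx; rewrite gt_max => /andP[Mx x1]; rewrite ler_norml => /andP[Bx _].
exists x => //; have := D_ge0 x ltac:(lra); rewrite /D => Dx.
rewrite ler_pdivrMr; last by lra.
have : k * Q 1 <= k * Q x by rewrite ler_wpM2l ?(ltW k0)// Qmono// ltW.
by lra.
Qed.

End Linearization.

(** * The curve of solutions *)

Section Nonlinearity.
Context {R : realType}.
Implicit Types (f : R -> R -> R) (a b c d e x y s t M : R).

(** For s > 0 the constraint 0 <= s + h holds for all small h, so the relative difference quotient
    has the ordinary filter. *)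
Lemma pd2_plus_derive f x s : C1_half_plane f -> 0 < s ->
  is_derive s 1 (f x) (pd2_plus f x s).
Proof.
move=> [_ h _ _] s0; have {h} := h x s (ltW s0); rewrite /pd2_plus /dquot_plus.
have -> : within [set h | 0 <= s + h] (0 : R)^' = (0 : R)^'.
  have A : \forall h \near (0 : R)^', 0 <= s + h.
    apply/nbhs_dist; exists s => // y; rewrite subr0 ltr_norml => /andP[h _] _.
    lra.
  apply/seteqP; split=> P hP; last by apply: filterS hP => h Ph _.
  have hP' : \forall h \near (0 : R)^', 0 <= s + h -> P h by exact: hP.
  by apply: filterS2 A hP' => h h1; apply.
have -> : (fun h => h^-1 * (f x (s + h) - f x s)) =
    (fun h => h^-1 *: (f x (h *: 1 + s) - f x s)).
  by apply/funext => h; rewrite /GRing.scale/= mulr1 (addrC s).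
by move=> h; apply: DeriveDef.
Qed.

Section Fixed.
Context (f : R -> R -> R) (hf : C1_half_plane f) (h5 : A5 f).

Lemma f_decreasing x y s : 0 <= x < y -> 0 < s -> f y s < f x s.
Proof.
move=> /andP[x0 xy] s0; case: hf => hf1 _ _ _.
apply: (derive_lt0_lt (f := f^~ s) (df := (pd1 f)^~ s) xy).
  by move=> t _; apply: derivable_is_derive; apply: hf1; exact: ltW.
by move=> t /andP[xt _]; have [] := h5 (le_lt_trans x0 xt) s0.
Qed.

Lemma pd1_ftilde x s : pd1 (ftilde f) x s = pd1 f x (s ^+ 2) * s.
Proof.
case: hf => hf1 _ _ _; rewrite /pd1 /ftilde.
have := is_deriveM1 (derivable_is_derive (hf1 x (s ^+ 2) (sqr_ge0 s))) (is_derive1_cst s x).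
by move=> /is_derive1P[_ ->]; rewrite mulr0 addr0.
Qed.

Lemma pd2_ftilde x s : 0 < s ->
  pd2 (ftilde f) x s = f x (s ^+ 2) + 2 * s ^+ 2 * pd2_plus f x (s ^+ 2).
Proof.
move=> s0; have d := pd2_plus_derive x hf (exprn_gt0 2 s0).
have := is_deriveM1 (is_derive_comp1 (f := f x) (g := fun y => y ^+ 2) d (is_deriveX1 1 (is_derive1_id s))) (is_derive1_id s).
by move=> /is_derive1P[_ e]; rewrite /pd2 /ftilde e; ring.
Qed.

Lemma f_lt_pd2_ftilde x s : 0 < x -> 0 < s -> f x (s ^+ 2) < pd2 (ftilde f) x s.
Proof.
move=> x0 s0; rewrite pd2_ftilde// ltrDl mulr_gt0 ?mulr_gt0 ?exprn_gt0//.
by have [] := h5 x0 (exprn_gt0 2 s0).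
Qed.

Lemma pd1_ftilde_lt0 x s : 0 < x -> 0 < s -> pd1 (ftilde f) x s < 0.
Proof.
move=> x0 s0; rewrite pd1_ftilde nmulr_rlt0//.
by have [] := h5 x0 (exprn_gt0 2 s0).
Qed.

(** The second factor is w at u = s, namely s^3 times the second partial derivative of f at s^2; it
    cancels the denominator of [hfun]. *)
Lemma hfun_ftilde x s : 0 < x -> 0 < s ->
  (hfun f x (s ^+ 2) + 1) * ((pd2 (ftilde f) x s - f x (s ^+ 2)) * s / 2)
  = 2 * ftilde f x s + x * pd1 (ftilde f) x s.
Proof.
move=> x0 s0; have [_ p0] := h5 x0 (exprn_gt0 2 s0).
rewrite pd2_ftilde// pd1_ftilde /hfun /ftilde; field.
by rewrite !gt_eqF.
Qed.

End Fixed.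

Lemma f_vanishing f : A0 f -> forall e, 0 < e ->
  exists M, forall x s, M <= x -> 0 <= s -> `|f x s| <= e.
Proof.
move=> [_ _ h] e /h[M hM]; exists M => x s Mx s0; apply/ltW/hM => //.
by apply: le_trans Mx _; exact: ler_norm.
Qed.

End Nonlinearity.

(** * Regularity and symmetry of solutions, and the derivative of the curve *)

Section Curve.
Context {R : realType}.
Notation mu := (@lebesgue_measure R).
Implicit Types (v w phi : R -> R) (a b c d e x y s t M h : R).

Lemma Rint_dominated (F_ : nat -> R -> R) (F G : R -> R) :
  (forall n, measurable_fun setT (F_ n)) -> measurable_fun setT F ->
  (forall x, F_ n x @[n --> \oo] --> F x) -> integrableR G ->
  (forall n x, `|F_ n x| <= G x) ->
  \int[mu]_x F_ n x @[n --> \oo] --> \int[mu]_x F x.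
Proof.
move=> mF_ mF F_F intG FG.
have [|||||iF _] := @dominated_convergence _ _ _ mu setT measurableT
  (fun n => EFin \o F_ n) (EFin \o F) (EFin \o G).
- by move=> n; apply/measurable_EFinP; exact: mF_.
- by apply/measurable_EFinP; exact: mF.
- apply/nearW => x _; apply: cvg_EFin; first by apply/nearW.
  exact: F_F.
- exact: intG.
- by apply/nearW => x n _; rewrite /= lee_fin.
have -> : (\int[mu]_x (EFin \o F) x = (\int[mu]_x F x)%:E)%E.
  by rewrite /Rintegral fineK//; exact: integrable_fin_num.
by move/fine_cvg.
Qed.

Lemma pd2_bounded (g : R -> R -> R) a b : C1_plane g ->
  exists2 C, 0 <= C & forall x s, `|x| <= a -> `|s| <= b -> `|pd2 g x s| <= C.
Proof.
move=> [_ _ _ c2].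
have cK : compact (`[- a, a]%classic `*` `[- b, b]%classic : set (R * R)).
  by apply: compact_setX; exact: segment_compact.
have [N [_ hN]] := compact_bounded (continuous_compact (continuous_subspaceT c2) cK).
exists (`|N| + 1); first by rewrite addr_ge0.
move=> x s xa sb; apply: (hN (`|N| + 1)); first by rewrite ltr_pwDr// ler_norm.
by exists (x, s) => //; split; rewrite /= in_itv/= -ler_norml.
Qed.

Lemma even_derive0 v v' : (forall x, v (- x) = v x) ->
  (forall x, is_derive x 1 v (v' x)) -> v' 0 = 0.
Proof.
move=> ev dv; have d0 : is_derive (- 0 : R) 1 v (v' 0) by rewrite oppr0.
have := is_derive_comp1 d0 (is_deriveN1 (is_derive1_id (0 : R))).
have -> : (fun y => v (- y)) = v by apply/funext.
by move=> /is_derive1P[_]; have /is_derive1P[_ ->] := dv 0; lra.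
Qed.

Lemma weak_solution_C2 (f : R -> R -> R) (l : R) v : C1_plane (ftilde f) ->
  continuous v -> weak_solution f l v ->
  exists v' : R -> R, (forall x, is_derive x 1 v (v' x)) /\
    forall x, is_derive x 1 v' (l * v x - ftilde f x (v x)).
Proof.
move=> hg cv hv; have cg := continuous_chain2 hg cv.
have clv : continuous (fun x => l * v x).
  by apply: continuousMfun => //; exact: cst_continuous.
apply: weak_derivative_C2 => //; first exact: continuousBfun.
move=> phi tphi; under [RHS]eq_Rint do rewrite mulrBl.
rewrite RintB; [|exact: test_function_integrable..].
under [X in _ = X - _]eq_Rint do rewrite -mulrA.
rewrite RintZ; last exact: test_function_integrable.
by rewrite -(hv _ tphi) /ftilde addrK.
Qed.

Lemma weak_solution_oppr (f : R -> R -> R) (l : R) v : C1_plane (ftilde f) -> A4 f ->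
  continuous v -> weak_solution f l v -> weak_solution f l (fun x => v (- x)).
Proof.
move=> hg h4 cv hv phi tphi; have [tN _ dN] := test_function_oppr tphi.
have tphi' := test_function_derive (test_function_is_derive tphi) tphi.
have tphi'' := test_function_derive (test_function_is_derive tphi') tphi'.
rewrite (Rint_oppr_test cv tphi'') (Rint_oppr_test cv tphi).
have -> : \int[mu]_x (f x (v (- x) ^+ 2) * v (- x) * phi x) =
    \int[mu]_x (f x (v x ^+ 2) * v x * phi (- x)).
  rewrite -(Rint_oppr_test (continuous_chain2 hg cv) tphi); apply: eq_Rint => x.
  by rewrite /ftilde (h4 x (v (- x) ^+ 2)) ?sqr_ge0.
by rewrite -(hv _ tN) dN.
Qed.

Section Derivative.
Context (f : R -> R -> R) (L l : R) (u du : R -> R -> R).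
Let g := ftilde f.
Let v := du l.
Let w h x := h^-1 * (u (l + h) x - u l x).
Context (hg : C1_plane g) (lL : 0 < l < L).
Context (uH1 : forall m, 0 < m < L -> H1 (u m)) (vH1 : H1 v).
Context (u_eq : forall m, 0 < m < L -> weak_solution f m (u m)).
Context (u_even : forall m, 0 < m < L -> forall x, u m (- x) = u m x).
Context (u_diff : H1norm (h^-1 *: (u (l + h) - u l) - v) @[h --> 0^'] --> 0).

Let quotient e : 0 < e -> exists2 d, 0 < d & forall h, h != 0 -> `|h| < d ->
  [/\ 0 < l + h < L, H1 (fun x => w h x - v x) & H1norm (fun x => w h x - v x) <= e].
Proof.
move=> e0; have /cvgrPdist_le/(_ _ e0) := u_diff; rewrite near_withinE.
move=> /nbhs_dist[d d0 hd]; have [l0 l1] := andP lL.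
exists (Num.min d (Num.min l (L - l))); first by rewrite !lt_min d0 l0 subr_gt0.
move=> h h0; rewrite !lt_min => /and3P[hd' hl hL].
have lh : 0 < l + h < L.
  by move: hl hL; rewrite !ltr_norml => /andP[? ?] /andP[? ?]; apply/andP; split; lra.
split => //.
  by apply: H1B => //; apply: H1Z; apply: H1B; exact: uH1.
have := hd h; rewrite subr0 => /(_ hd' h0); rewrite sub0r normrN => /(le_trans _); apply.
exact: ler_norm.
Qed.

(** The H^1 norm bounds the supremum up to a factor sqrt 2, so e / 2 in norm is enough. *)
Let quotient_sup e : 0 < e -> exists2 d, 0 < d & forall h, h != 0 -> `|h| < d ->
  0 < l + h < L /\ forall x, `|w h x - v x| <= e.
Proof.
move=> e0; have [d d0 hd] := quotient (ltac:(lra) : 0 < e / 2).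
exists d => // h h0 /(hd _ h0)[lh hH hn]; split => // x.
have := H1_sup x hH; set t := _ - _ => ht.
have n0 : 0 <= H1norm (fun x => w h x - v x) by exact: sqrtr_ge0.
rewrite -(@ler_pXn2r _ 2) ?nnegrE ?(ltW e0)// real_normK ?num_real//.
by nra.
Qed.

(** The function v is a uniform limit of difference quotients of even functions. *)
Lemma derivative_even x : v (- x) = v x.
Proof.
apply/eqP; rewrite -subr_eq0 -normr_le0; apply/ler_addgt0Pr => e e0; rewrite add0r.
have [d d0 hd] := quotient_sup (ltac:(lra) : 0 < e / 2).
have d20 : d / 2 != 0 by rewrite gt_eqF//; lra.
have [|lh h] := hd (d / 2) d20; first by rewrite gtr0_norm; lra.
have := h x; have := h (- x); rewrite /w (u_even lh) (u_even lL) !ler_norml.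
by move=> /andP[? ?] /andP[? ?]; apply/andP; split; lra.
Qed.

(** The weak equations at l + h and l are subtracted, divided by h and passed to the limit by
    dominated convergence along a sequence. This gives the linearised equation weakly; its terms are
    continuous, so [weak_derivative_C2] applies. *)
Lemma derivative_C2 : exists v' : R -> R, (forall x, is_derive x 1 v (v' x)) /\
  forall x, is_derive x 1 v' (l * v x - pd2 g x (u l x) * v x + u l x).
Proof.
have [cv _ _] := vH1; have [cu _ _] := uH1 lL.
have cq := continuous_pd2_comp hg cu.
have cqv : continuous (fun x => pd2 g x (u l x) * v x) by exact: continuousMfun.
have clv : continuous (fun x => l * v x).
  by apply: continuousMfun => //; exact: cst_continuous.
have crhs : continuous (fun x => l * v x - pd2 g x (u l x) * v x + u l x).
  by move=> x; apply: cvgD; [exact: continuousBfun clv cqv x|exact: cu].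
apply: weak_derivative_C2 => // phi tphi.
have tphi' := test_function_derive (test_function_is_derive tphi) tphi.
have tphi'' := test_function_derive (test_function_is_derive tphi') tphi'.
rewrite -[derive1 (derive1 phi)]/(derive1n 2 phi) in tphi''.
set phi2 := derive1n 2 phi in tphi'' *.
have [d d0 hd] := quotient_sup (@ltr01 R).
(* The factor d / 2 keeps every term in the range where the quotients stay within 1 of v, which
   yields bounds uniform in n. *)
pose h n : R := d / 2 * harmonic n.
have h0 n : 0 < h n by rewrite /h mulr_gt0 ?divr_gt0// harmonic_gt0.
have hnd n : `|h n| < d.
  rewrite gtr0_norm// /h /harmonic/= ltr_pdivrMr//.
  have : 1 <= n.+1%:R :> R by rewrite ler1n.
  by nra.
have h_cvg : h n @[n --> \oo] --> (0 : R).
  by rewrite -[X in _ --> X](mulr0 (d / 2)); apply: cvgM; [exact: cvg_cst|exact: cvg_harmonic].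
have lh n : 0 < l + h n < L by have [] := hd (h n) (lt0r_neq0 (h0 n)) (hnd n).
have wv n x : `|w (h n) x - v x| <= 1.
  by have [_] := hd (h n) (lt0r_neq0 (h0 n)) (hnd n); exact.
have w_cvg x : w (h n) x @[n --> \oo] --> v x.
  apply/cvgrPdist_le => e e0; have [d' d'0 hd'] := quotient_sup e0.
  have /cvgrPdist_lt/(_ _ d'0) := h_cvg; apply: filterS => n; rewrite sub0r normrN => hn.
  by rewrite distrC; have [_] := hd' (h n) (lt0r_neq0 (h0 n)) hn; exact.
have uE n x : u (l + h n) x = u l x + h n * w (h n) x.
  by rewrite /w mulrA divff ?gt_eqF// mul1r; ring.
have u_cvg x : u (l + h n) x @[n --> \oo] --> u l x.
  rewrite (_ : (fun n => _) = (fun n => u l x + h n * w (h n) x)).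
    by rewrite -[X in _ --> X]addr0 -(mul0r (v x)); apply: cvgD; [exact: cvg_cst|exact: cvgM].
  by apply/funext => n; exact: uE.
pose k n x := (h n)^-1 * (g x (u (l + h n) x) - g x (u l x)).
have k_cvg x : k n x @[n --> \oo] --> pd2 g x (u l x) * v x.
  (* The slope function also covers the indices where u (l + h n) x = u l x, at which a quotient in
     s would be undefined. *)
  have /is_derive1_caratheodory[G [GE cG Gx]] := is_derive_pd2 hg x (u l x).
  have kE n : k n x = G (u (l + h n) x) * w (h n) x.
    by rewrite /k GE /w mulrCA.
  rewrite (funext kE); apply: cvgM => //; rewrite -Gx.
  by apply: (cvg_comp _ _ (u_cvg x)); exact: cG.
have bnd z : H1 z -> exists2 C, 0 <= C & forall x, `|z x| <= C.
  move=> Hz; exists (2 * H1norm z); first by rewrite mulr_ge0// sqrtr_ge0.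
  move=> x; have := H1_sup x Hz.
  have n0 : 0 <= H1norm z by exact: sqrtr_ge0.
  move=> hz; rewrite -(@ler_pXn2r _ 2) ?nnegrE ?mulr_ge0// real_normK ?num_real//.
  by nra.
have [V V0 hV] := bnd _ vH1; have [U U0 hU] := bnd _ (uH1 lL).
have wb n x : `|w (h n) x| <= V + 1.
  rewrite -(subrK (v x) (w (h n) x)); apply: le_trans (ler_normD _ _) _.
  by have := wv n x; have := hV x; lra.
pose U' := U + d * (V + 1).
have U'0 : 0 <= U' by rewrite addr_ge0// mulr_ge0//; [exact: ltW|lra].
have ub n x : `|u (l + h n) x| <= U'.
  rewrite uE; apply: le_trans (ler_normD _ _) _; rewrite lerD//.
  by rewrite normrM ler_pM// ltW.
have ub0 x : `|u l x| <= U'.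
  by apply: le_trans (hU x) _; rewrite lerDl mulr_ge0//; [exact: ltW|lra].
have [_ [M sphi]] := (test_functionP phi).1 tphi.
(* The bound on g_s is local: it is taken over a segment containing the support of phi and the
   common range of the functions u (l + h n). *)
have [C C0 hC] := pd2_bounded M U' hg.
have kb n x : `|x| <= M -> `|k n x| <= C * (V + 1).
  move=> xM; rewrite /k.
  have [z zb ->] := mean_value_between (u l x) (u (l + h n) x) (is_derive_pd2 hg x).
  rewrite mulrCA normrM; apply: ler_pM => //; last exact: wb.
  apply: hC => //.
  move: zb (ub n x) (ub0 x); rewrite !ler_norml.
  case: (lerP (u l x) (u (l + h n) x)) => _ /andP[z1 z2] /andP[b1 b2] /andP[b3 b4];
    apply/andP; split; lra.
have wsol m : 0 < m < L ->
    integrableR (fun x => u m x * phi2 x + (g x (u m x) - m * u m x) * phi x) /\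
    \int[mu]_x (u m x * phi2 x + (g x (u m x) - m * u m x) * phi x) = 0.
  move=> hm; have [cm _ _] := uH1 hm; have cgm := continuous_chain2 hg cm.
  have i1 := test_function_integrable cm tphi''.
  have i2 := test_function_integrable cgm tphi.
  have i3 := test_function_integrable cm tphi.
  have E x : u m x * phi2 x + (g x (u m x) - m * u m x) * phi x =
      (u m x * phi2 x + g x (u m x) * phi x) - m * (u m x * phi x) by ring.
  under eq_Rint do rewrite E.
  rewrite (_ : (fun x => _) = (fun x => (u m x * phi2 x + g x (u m x) * phi x)
    - m * (u m x * phi x))); last by apply/funext.
  split; first by apply: integrableRB; [exact: integrableRD|exact: integrableRZ].
  rewrite RintB ?RintD ?RintZ//; [|exact: integrableRD|exact: integrableRZ].
  by have := u_eq hm tphi; rewrite -/phi2 /g /ftilde => ->; rewrite subrr.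
(* This is the difference of the two tested equations divided by h n; its last term u (l + h n)
   comes from the increment of the factor l. *)
pose F n x := w (h n) x * phi2 x + (k n x - l * w (h n) x - u (l + h n) x) * phi x.
have FE n x : F n x = (h n)^-1 *
    ((u (l + h n) x * phi2 x + (g x (u (l + h n) x) - (l + h n) * u (l + h n) x) * phi x)
    - (u l x * phi2 x + (g x (u l x) - l * u l x) * phi x)).
  by rewrite /F /w /k; field; rewrite gt_eqF.
have iF n : integrableR (F n) /\ \int[mu]_x F n x = 0.
  have [i1 e1] := wsol _ (lh n); have [i2 e2] := wsol _ lL.
  under eq_Rint do rewrite FE.
  have i3 := integrableRB i1 i2.
  rewrite RintZ// RintB// e1 e2 subrr mulr0; split => //.
  by rewrite (funext (FE n)); exact: integrableRZ.
pose F0 x := v x * phi2 x + (pd2 g x (u l x) * v x - l * v x - u l x) * phi x.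
have F0E x : F0 x = v x * phi2 x - (l * v x - pd2 g x (u l x) * v x + u l x) * phi x.
  by rewrite /F0; ring.
have j1 := test_function_integrable cv tphi''.
have j2 := test_function_integrable crhs tphi.
have := @Rint_dominated F F0 (fun x => (V + 1) * `|phi2 x| +
  (C * (V + 1) + l * (V + 1) + U') * `|phi x|).
have lim0 : \int[mu]_x F n x @[n --> \oo] --> (0 : R).
  by rewrite (funext (fun n => (iF n).2)); exact: cvg_cst.
move=> /(_ (fun n => integrableR_measurable (iF n).1)) H.
have : \int[mu]_x F0 x = 0.
  apply: (cvg_unique _ (H _ _ _ _) lim0).
  - exact: norm_hausdorff.
  - by rewrite (funext F0E); apply: integrableR_measurable; exact: integrableRB.
  - move=> x; apply: cvgD; first by apply: cvgM; [exact: w_cvg|exact: cvg_cst].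
    apply: cvgM; last exact: cvg_cst.
    apply: cvgB => //; apply: cvgB => //.
    by apply: cvgM; [exact: cvg_cst|exact: w_cvg].
  - have i1 := test_function_integrable (@cst_continuous _ _ (1 : R)) tphi''.
    have i2 := test_function_integrable (@cst_continuous _ _ (1 : R)) tphi.
    have n1 : integrableR (fun x => `|phi2 x|).
      by have := integrableR_norm i1; congr integrableR; apply/funext => x; rewrite mul1r.
    have n2 : integrableR (fun x => `|phi x|).
      by have := integrableR_norm i2; congr integrableR; apply/funext => x; rewrite mul1r.
    by apply: integrableRD; exact: integrableRZ.
  - move=> n x; rewrite /F; apply: le_trans (ler_normD _ _) _.
    rewrite (normrM (w (h n) x)) (normrM (_ - _)) lerD//.
      by rewrite ler_wpM2r//; exact: wb.
    case: (leP `|x| M) => [xM|/sphi ->]; last by rewrite normr0 !mulr0.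
    rewrite ler_wpM2r//; apply: le_trans (ler_normB _ _) _; rewrite lerD//.
    apply: le_trans (ler_normB _ _) _; rewrite lerD ?kb//.
    have [l0 _] := andP lL.
    by rewrite (normrM l) (gtr0_norm l0) ler_wpM2l ?(ltW l0)//; exact: wb.
under eq_Rint do rewrite F0E.
by rewrite RintB// => /eqP; rewrite subr_eq0 => /eqP.
Qed.

(** With u(l + h) = u + h (v + z) and z small in L^2, the error of the difference quotient of the
    integral is 2 times the integral of u z plus h times that of (v + z)^2. *)
Lemma derivative_norm2 :
  is_derive l 1 (fun m => \int[mu]_x (u m x ^+ 2)) (2 * \int[mu]_x (u l x * v x)).
Proof.
have [cv lv _] := vH1; have [cu lu _] := uH1 lL.
set I := \int[mu]_x (u l x * v x).
set A := \int[mu]_x (u l x ^+ 2); set V := \int[mu]_x (v x ^+ 2).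
have A0 : 0 <= A by apply: Rint_ge0 => x; exact: sqr_ge0.
have V0 : 0 <= V by apply: Rint_ge0 => x; exact: sqr_ge0.
have key e : 0 < e -> exists2 d, 0 < d & forall h, h != 0 -> `|h| < d ->
    `|h^-1 * (\int[mu]_x (u (l + h) x ^+ 2) - A) - 2 * I| <= e.
  (* Cauchy-Schwarz bounds the integral of u z by (A + 1) m, where A + 1 avoids a square root; the
     remaining term contributes at most (2 V + 2) m. *)
  move=> e0; pose m := Num.min 1 (e / (2 * (A + 1) + 2 * V + 2)).
  have c0 : 0 < 2 * (A + 1) + 2 * V + 2 by lra.
  have m0 : 0 < m by rewrite lt_min ltr01 divr_gt0.
  have m1 : m <= 1 by rewrite ge_min lexx.
  have me : m * (2 * (A + 1) + 2 * V + 2) <= e by rewrite -ler_pdivlMr// ge_min lexx orbT.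
  have [d d0 hd] := quotient m0.
  exists (Num.min d m); first by rewrite lt_min d0.
  move=> h h0; rewrite lt_min => /andP[hd' hm]; have [lh zH zm] := hd h h0 hd'.
  pose z x := w h x - v x; have [cz lz _] := zH; rewrite -/z in lz.
  have uE x : u (l + h) x = u l x + h * (v x + z x).
    by rewrite /z /w subrKC mulrA divff// mul1r; ring.
  have i1 := L2_sqr lu; have i2 := L2M lu lv; have i3 := L2M lu lz.
  have lvz : L2 (fun x => v x + z x) := L2D lv lz.
  have i4 := L2_sqr lvz.
  have iz := L2_sqr lz; have iv := L2_sqr lv.
  have E : \int[mu]_x (u (l + h) x ^+ 2) = A + (2 * h * (I + \int[mu]_x (u l x * z x))
      + h ^+ 2 * \int[mu]_x ((v x + z x) ^+ 2)).
    have -> : \int[mu]_x (u (l + h) x ^+ 2) = \int[mu]_x (u l x ^+ 2 +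
        (2 * h * (u l x * v x + u l x * z x) + h ^+ 2 * (v x + z x) ^+ 2)).
      by apply: eq_Rint => x; rewrite uE; ring.
    by rewrite !RintD ?RintZ ?RintD//; do ?[exact: integrableRZ|exact: integrableRD|apply: integrableRD|apply: integrableRZ].
  rewrite E; have -> : h^-1 * (A + (2 * h * (I + \int[mu]_x (u l x * z x))
      + h ^+ 2 * \int[mu]_x ((v x + z x) ^+ 2)) - A) - 2 * I =
      2 * \int[mu]_x (u l x * z x) + h * \int[mu]_x ((v x + z x) ^+ 2) by field.
  have Z2 : \int[mu]_x (z x ^+ 2) <= m ^+ 2.
    apply: le_trans (H1_L2 zH) _; apply: lerXn2r; rewrite ?nnegrE ?sqrtr_ge0//.
    exact: ltW.
  have Z0 : 0 <= \int[mu]_x (z x ^+ 2) by apply: Rint_ge0 => x; exact: sqr_ge0.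
  have CS : `|\int[mu]_x (u l x * z x)| <= (A + 1) * m.
    rewrite -(@ler_pXn2r _ 2) ?nnegrE ?mulr_ge0 ?(ltW m0)//; last by lra.
    rewrite real_normK ?num_real//; apply: le_trans (Cauchy_Schwarz_L2 lu lz) _.
    rewrite exprMn -/A; apply: ler_pM => //; by nra.
  have VZ : \int[mu]_x ((v x + z x) ^+ 2) <= 2 * V + 2 * m ^+ 2.
    apply: (@le_trans _ _ (\int[mu]_x (2 * v x ^+ 2 + 2 * z x ^+ 2))).
      apply: le_Rint => //.
        by apply: integrableRD; exact: integrableRZ.
      by move=> x; have := sqr_ge0 (v x - z x); nra.
    by rewrite RintD ?RintZ//; [rewrite -/V; lra|exact: integrableRZ|exact: integrableRZ].
  have VZ0 : 0 <= \int[mu]_x ((v x + z x) ^+ 2) by apply: Rint_ge0 => x; exact: sqr_ge0.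
  apply: le_trans (ler_normD _ _) _.
  rewrite [`|2 * _|]normrM [`|h * _|]normrM (ger0_norm VZ0) (ger0_norm (ler0n _ 2)).
  have mm : m ^+ 2 <= 1 by rewrite expr_le1// ltW.
  have : `|h| * \int[mu]_x ((v x + z x) ^+ 2) <= m * (2 * V + 2).
    by apply: ler_pM => //; [exact: ltW|lra].
  by lra.
apply/is_derive1_caratheodory.
pose N m := \int[mu]_x (u m x ^+ 2).
exists (fun m => if m == l then 2 * I else (N m - N l) / (m - l)); split.
- move=> m; case: eqVneq => [->|ml]; first by rewrite !subrr mulr0.
  by rewrite divfK// subr_eq0.
- apply/continuousP_dist => e e0; rewrite eqxx.
  have [d d0 hd] := key (e / 2) ltac:(lra); exists d => // m md.
  case: eqVneq => [_|ml]; first by rewrite subrr normr0.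
  have := hd (m - l); rewrite subr_eq0 ml => /(_ isT md).
  by rewrite subrKC mulrC -/(N m) -/(N l) => /le_lt_trans; apply; lra.
- by rewrite eqxx.
Qed.

End Derivative.

End Curve.

Theorem proposition3p5 (R : realType) (f : R -> R -> R) (b p : R)
    (finf : R -> R) (u : R -> R -> R)
    (hf : C1_half_plane f)
    (h0 : A0 f) (h1 : A1 f) (h2 : A2 f b p) (h3 : A3 f b p) (h4 : A4 f)
    (h5 : A5 f) (h6 : A6 f) (h7 : A7 f finf) (hH : AH f)
    (hu : C1_curve_H1 0 (lambda_inf finf) u)
    (hsol : forall l : R, 0 < l < lambda_inf finf ->
       positive_H1_solution f l (u l) /\
       (forall v : R -> R, positive_H1_solution f l v -> v = u l)) :
  let N := fun l : R => (\int[@lebesgue_measure R]_x (u l x ^+ 2))%R in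
  forall l : R, 0 < l < lambda_inf finf -> derivable N l 1 /\ 0 < derive1 N l.
Proof.
move=> N l lL; have [l0 _] := andP lL.
case: h1 => hg _ _; case: hu => du hdu.
have uH1 m : 0 < m < lambda_inf finf -> H1 (u m) by move=> /hsol[[]].
have u_eq m : 0 < m < lambda_inf finf -> weak_solution f m (u m) by move=> /hsol[[]].
have u0 x : 0 < u l x by have [[_ _ h] _] := hsol l lL; exact: h.
have u_even m : 0 < m < lambda_inf finf -> forall x, u m (- x) = u m x.
  move=> hm x; have [[Hm wm pm] uniq] := hsol m hm; have [cm _ _] := Hm.
  (* The reflected function is again a positive solution, so uniqueness identifies it with u m. *)
  suff E : (fun x => u m (- x)) = u m by rewrite -{2}E.
  apply: uniq; split; [exact: H1_oppr|exact: weak_solution_oppr|].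
  by move=> y; exact: pm.
have [_ vH1 u_diff _] := hdu l lL.
have [cu lu _] := uH1 l lL; have [cv lv _] := vH1.
have [u1 [du0 du1]] := weak_solution_C2 hg cu (u_eq l lL).
have v_even := derivative_even lL uH1 vH1 u_even u_diff.
have [v1 [dv dv1]] := derivative_C2 hg lL uH1 vH1 u_eq u_diff.
have [P dP P0] := continuous_primitive (continuousMfun cu cv).
have [k k0 hk] := linearization_positive hg l0 (f_decreasing hf h5) (f_vanishing h0)
  (f_lt_pd2_ftilde hf h5) (pd1_ftilde_lt0 hf h5) (hfun_ftilde hf h5) hH u0 du0 du1
  (H1_decay (uH1 l lL)) (even_derive0 (u_even l lL) du0) dv dv1 (H1_decay vH1)
  (even_derive0 v_even dv) dP P0.
have P_odd x : P (- x) = - P x.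
  have d (y : R) : is_derive y 1 (fun y => P y + P (- y)) 0.
    apply: is_derive_eq (is_deriveD1 (dP y)
      (is_derive_comp1 (dP (- y)) (is_deriveN1 (is_derive1_id y)))) _.
    by rewrite u_even// v_even; ring.
  have := derive_eq0_cst d x 0; rewrite oppr0 P0 addr0 => /eqP.
  by rewrite addrC addr_eq0 => /eqP.
have I0 : 0 < \int[@lebesgue_measure R]_x (u l x * du l x).
  (* As [P] is odd, the integral is the limit of 2 P x. At a far point with P x >= k, being within k
     of 2 P x leaves at least k. *)
  have /cvgrPdist_le/(_ k k0) :=
    Rint_cvg_segments (continuousMfun cu cv) (L2M lu lv) dP.
  move=> [M [_ hM]]; have [x Mx kx] := hk M.
  by have := hM x Mx; rewrite P_odd ler_norml; lra.
have /is_derive1P[dN ->] := derivative_norm2 lL uH1 vH1 u_diff.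
by split => //; rewrite mulr_gt0.
Qed.
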